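(* Let $\mathbf n=(n_1,\ldots,n_k)\in\mathbb N^k$ with $n_i\ge2$ for all $i$. If $\mathcal M$ is a graded (closed) invariant subspace of the tensor product $F^2(H_{n_1})\otimes\cdots\otimes F^2(H_{n_k})$, then $$\lim_{q_1\to\infty}\cdots\lim_{q_k\to\infty}\frac{\mathrm{rank}\left[P_{\mathcal M^\perp}P_{\le(q_1,\ldots,q_k)}\right]}{\mathrm{rank}\left[P_{\le(q_1,\ldots,q_k)}\right]}=\lim_{q_1\to\infty}\cdots\lim_{q_k\to\infty}\frac{\mathrm{trace}\left[P_{\mathcal M^\perp}P_{\le(q_1,\ldots,q_k)}\right]}{\mathrm{trace}\left[P_{\le(q_1,\ldots,q_k)}\right]}.$$ This is equivalent to $$\chi(P_{\mathcal M^\perp}\mathbf S|_{\mathcal M^\perp})=\mathrm{curv}(P_{\mathcal M^\perp}\mathbf S|_{\mathcal M^\perp}).$$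
   Context: $H_{n_i}$ is an $n_i$-dimensional complex Hilbert space with orthonormal basis $e^i_1,\ldots,e^i_{n_i}$, and $F^2(H_{n_i}):=\mathbb C1\oplus\bigoplus_{p\ge1}H_{n_i}^{\otimes p}$ has orthonormal basis $e^i_\alpha:=e^i_{j_1}\otimes\cdots\otimes e^i_{j_p}$ for words $\alpha=g^i_{j_1}\cdots g^i_{j_p}$ in the unital free semigroup $\mathbb F_{n_i}^+$ on generators $g^i_1,\ldots,g^i_{n_i}$ (with $e^i_{g^i_0}:=1$ for the identity $g_0^i$); $|\alpha|$ is word length. $S_{i,j}e^i_\alpha:=e^i_{g^i_j\alpha}$; $\mathbf S_{i,j}$ acts on $\bigotimes_{i=1}^kF^2(H_{n_i})$ as $S_{i,j}$ on the $i$-th factor and the identity on the others; $\mathbf S=(\mathbf S_{i,j})$. Invariant means invariant under each $\mathbf S_{i,j}$. $\mathcal M$ is graded if $U(\lambda)\mathcal M\subseteq\mathcal M$ for all $\lambda\in\mathbb T^k$, where $U$ is the canonical gauge group, i.e. the unitary representation of the torus $\mathbb T^k$ with $U(\lambda)(e^1_{\alpha_1}\otimes\cdots\otimes e^k_{\alpha_k})=\lambda_1^{|\alpha_1|}\cdots\lambda_k^{|\alpha_k|}e^1_{\alpha_1}\otimes\cdots\otimes e^k_{\alpha_k}$. $P_{\le(q_1,\ldots,q_k)}$ is the orthogonal projection onto the span of $e^1_{\alpha_1}\otimes\cdots\otimes e^k_{\alpha_k}$ with $|\alpha_i|\le q_i$. $P_{\mathcal M^\perp}\mathbf S|_{\mathcal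 M^\perp}$ is the tuple on $\mathcal M^\perp$ with entries $P_{\mathcal M^\perp}\mathbf S_{i,j}|_{\mathcal M^\perp}$. For a tuple $\mathbf T=(T_1,\ldots,T_k)$, $T_i=(T_{i,1},\ldots,T_{i,n_i})$, on a Hilbert space $\mathcal H$ with entries of $T_s$ commuting with entries of $T_t$ for $s\neq t$, put $\Phi_{T_i}(Y):=\sum_jT_{i,j}YT_{i,j}^*$ and $\mathbf\Delta_{\mathbf T}(I):=(id-\Phi_{T_1})\circ\cdots\circ(id-\Phi_{T_k})(I)$. $\mathbf T$ is in the regular polyball $\mathbf B_{\mathbf n}(\mathcal H)$ if $(id-\Phi_{T_1})^{p_1}\circ\cdots\circ(id-\Phi_{T_k})^{p_k}(I)\ge0$ for all $p_i\in\{0,1\}$. Assume $\mathbf T\in\mathbf B_{\mathbf n}(\mathcal H)$ and $\mathbf\Delta_{\mathbf T}(I)$ has finite rank. With $T_{i,\alpha}:=T_{i,j_1}\cdots T_{i,j_p}$ for $\alpha=g^i_{j_1}\cdots g^i_{j_p}$, $T_{i,g_0^i}:=I$, let $M_{\mathbf q}(\mathbf T):=\mathrm{span}\{T_{1,\alpha_1}\cdots T_{k,\alpha_k}h:|\alpha_i|\le q_i,\ h\in\mathbf\Delta_{\mathbf T}(I)(\mathcal H)\}$ for $\mathbf q\in\mathbb Z_+^k$. The Euler characteristic is $\chi(\mathbf T):=\lim_{m\to\infty}\dim M_{\mathbf q^{(m)}}(\mathbf T)/\prod_{i=1}^k(1+n_i+\cdots+n_i^{q_i^{(m)}})$ for any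 increasing cofinal sequence $\mathbf q^{(m)}$ in $\mathbb Z_+^k$ (the limit exists, independent of the sequence). Let $P_q^{(i)}$ be the orthogonal projection of $F^2(H_{n_i})$ onto the span of $e^i_\alpha$, $|\alpha|=q$, and let $\mathbf K_{\mathbf T}:\mathcal H\to\bigotimes_{i=1}^kF^2(H_{n_i})\otimes\overline{\mathbf\Delta_{\mathbf T}(I)(\mathcal H)}$, $\mathbf K_{\mathbf T}h:=\sum_{\beta_i\in\mathbb F_{n_i}^+}e^1_{\beta_1}\otimes\cdots\otimes e^k_{\beta_k}\otimes\mathbf\Delta_{\mathbf T}(I)^{1/2}T_{1,\beta_1}^*\cdots T_{k,\beta_k}^*h$. The curvature is $$\mathrm{curv}(\mathbf T):=\lim_{m\to\infty}\frac1{\binom{m+k}{k}}\sum_{\substack{q_1,\ldots,q_k\ge0\\ q_1+\cdots+q_k\le m}}\frac{\mathrm{trace}\left[\mathbf K_{\mathbf T}^*(P^{(1)}_{q_1}\otimes\cdots\otimes P^{(k)}_{q_k}\otimes I)\mathbf K_{\mathbf T}\right]}{\mathrm{trace}\left[P^{(1)}_{q_1}\otimes\cdots\otimes P^{(k)}_{q_k}\right]}$$ (the limit is known to exist). *)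

(* Defs.v *)
From HB Require Import structures.
From mathcomp Require Import all_boot all_order all_algebra sesquilinear.
From mathcomp Require Import complex finmap.
From mathcomp Require Import boolp classical_sets functions reals topology.
From mathcomp Require Import normedtype sequences ring.
From mathcomp.analysis.showcase Require summability.

(* Complex Hilbert spaces on top of the normed modules of MathComp-Analysis.
   Operators are plain functions between Hilbert spaces; linearity and
   continuity are stated separately. *)

Set Implicit Arguments.
Unset Strict Implicit.
Unset Printing Implicit Defensive.

Import Order.TTheory GRing.Theory Num.Theory Num.Def.
Import numFieldNormedType.Exports.

Local Open Scope classical_set_scope.
Local Open Scope complex_scope.
Local Open Scope ring_scope.

Section Dot.
Variables (C : numClosedFieldType) (U : lmodType C) (form : {dot U for conjC}).

Lemma dot_CauchySchwarz (u v : U) :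
  `|form u v| ^+ 2 <= form u u * form v v.
Proof.
have [-> | nz_v] := eqVneq v 0.
  by rewrite !linear0r normr0 expr0n mulr0.
pose a := form u v / form v v; pose w := u - a *: v.
have vv0 : form v v != 0 by rewrite dnorm_eq0.
have ow : form w v = 0 by rewrite /w linearBl/= linearZl_LR divfK ?subrr.
have -> : u = w + a *: v by rewrite subrK.
rewrite linearDl /= ow add0r linearZl_LR/= normrM (ger0_norm (dnorm_ge0 _ _)).
have wav : form w (a *: v) = 0 by rewrite linearZr_LR/= ow mulr0.
have avw : form (a *: v) w = 0 by rewrite hermC /= wav rmorph0 mulr0.
rewrite exprMn dnormD /= wav rmorph0 !addr0 dnormZ.
rewrite mulrDl [X in _ <= _ + X](_ : _ = `|a| ^+ 2 * form v v ^+ 2).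
  by rewrite lerDr mulr_ge0 // dnorm_ge0.
by rewrite [form v v ^+ 2]expr2 mulrA.
Qed.

Lemma dot_CauchySchwarz_sqrt (u v : U) :
  `|form u v| <= sqrtC (form u u) * sqrtC (form v v).
Proof.
have u0 := dnorm_ge0 form u; have v0 := dnorm_ge0 form v.
rewrite -(@ler_pXn2r _ 2) ?nnegrE ?mulr_ge0 ?sqrtC_ge0 //.
by rewrite exprMn !sqrtCK dot_CauchySchwarz.
Qed.

Lemma dot_triangle (u v : U) :
  sqrtC (form (u + v) (u + v)) <= sqrtC (form u u) + sqrtC (form v v).
Proof.
have u0 := dnorm_ge0 form u; have v0 := dnorm_ge0 form v.
rewrite -(@ler_pXn2r _ 2) ?nnegrE ?addr_ge0 ?sqrtC_ge0 ?dnorm_ge0 //.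
rewrite sqrrD !sqrtCK dnormD /= [leRHS]addrAC lerD2l.
have -> : form u v + (form u v)^* = ('Re (form u v)) *+ 2.
  by rewrite -mulr_natr ReE divfK // pnatr_eq0.
rewrite lerMn2r /=; apply: le_trans (dot_CauchySchwarz_sqrt u v).
by have [] := leif_Re_Creal (form u v).
Qed.

End Dot.

(* The norm and topology of R[i]^o, put on R[i] itself: the completeness instance
   of the reals already occupies the canonical completeType slot of _^o. *)
HB.instance Definition _ (R : realType) := NormedModule.copy R[i] R[i]^o.

Section ComplexComplete.
Variable R : realType.
Local Notation C := R[i].

Lemma complex_normE (z : C) : `|z| = (complex.Re `|z|)%:C.
Proof. by rewrite RRe_real // normr_real. Qed.

Lemma complex_norm_ge_Im (z : C) : (`|complex.Im z|)%:C <= `|z|.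
Proof.
case: z => a b; rewrite normc_def lecR /=.
by rewrite -[leLHS]sqrtr_sqr ler_wsqrtr // lerDr sqr_ge0.
Qed.

Lemma complex_norm_le (z : C) :
  `|z| <= (`|complex.Re z| + `|complex.Im z|)%:C.
Proof.
have zE : z = (complex.Re z)%:C + 'i%C * (complex.Im z)%:C.
  by case: z => a b; simpc.
rewrite {1}zE; apply: le_trans (ler_normD _ _) _.
rewrite normrM !normc_def /= !expr0n /= !(addr0, add0r) !sqrtr_sqr.
by rewrite normr1 mul1r raddfD.
Qed.

Lemma complex_cauchy_cvg (F : set_system C) :
  ProperFilter F -> cauchy F -> cvg F.
Proof.
move=> FF /cauchyP Fc.
have part (p : C -> R) (p_lip : forall x y : C, (`|p x - p y|)%:C <= `|x - y|) :
    exists a : R^o, p @ F --> a.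
  apply/cvg_ex; apply: (@cauchy_cvg R^o (p @ F)); apply/cauchyP => e e0.
  have /Fc[z Fz] : 0 < e%:C :> C by rewrite ltcR.
  exists (p z); apply: (@filterS _ F _ (ball z e%:C)) Fz => y; rewrite -!ball_normE /= => zy.
  by rewrite -(@ltcR R); apply: le_lt_trans zy.
have Re_lip (x y : C) : (`|complex.Re x - complex.Re y|)%:C <= `|x - y|.
  by rewrite -raddfB /=; exact: normc_ge_Re.
have Im_lip (x y : C) : (`|complex.Im x - complex.Im y|)%:C <= `|x - y|.
  by rewrite -raddfB /=; exact: complex_norm_ge_Im.
have [a Fa] := part _ Re_lip; have [b Fb] := part _ Im_lip.
apply/cvg_ex; exists (a +i* b); apply/cvgrPdist_lt => e e0.
have er : e = (complex.Re e)%:C by rewrite RRe_real // ger0_real // ltW.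
have e2 : 0 < complex.Re e / 2.
  by rewrite divr_gt0 // -(@ltcR R) -er.
move/cvgrPdist_lt: Fa => Fa; move/cvgrPdist_lt: Fb => Fb.
move: (Fa _ e2) (Fb _ e2); apply: filterS2 => z Faz Fbz.
apply: le_lt_trans (complex_norm_le _) _; rewrite !raddfB /=.
rewrite er ltcR [ltRHS]splitr; exact: ltrD.
Qed.

End ComplexComplete.

HB.instance Definition _ (R : realType) :=
  Uniform_isComplete.Build R[i] (@complex_cauchy_cvg R).

HB.mixin Record CompleteNormedModule_isHilbert (R : realType) V
    of CompleteNormedModule R[i] V := {
  hdot : {dot V for @conjC R[i]} ;
  hdotxx : forall x : V, hdot x x = `|x| ^+ 2 }.

#[short(type="hilbertType")]
HB.structure Definition Hilbert (R : realType) :=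
  {V of CompleteNormedModule_isHilbert R V & CompleteNormedModule R[i] V}.

Notation "'[ u , v ]" := (hdot u v) : ring_scope.

Section ScalarHilbert.
Variable R : realType.
Local Notation C := R[i].

Definition scalar_dot (x y : C) : C := x * y^*.

Lemma scalar_dot_bilinear :
  bilinear_for *%R (@conjC C \; *%R) scalar_dot.
Proof.
split=> [u a x y|u a x y]; rewrite /scalar_dot /=.
  by rewrite mulrDl -[a *: x]/(a * x) mulrA.
by rewrite rmorphD rmorphM mulrDr mulrCA.
Qed.

HB.instance Definition _ :=
  bilinear_isBilinear.Build _ _ _ _ _ _ scalar_dot scalar_dot_bilinear.

Lemma scalar_dot_herm (x y : C) :
  scalar_dot x y = (-1) ^+ false * (scalar_dot y x)^*.
Proof.
rewrite expr0 mul1r; suff H (a b : C) : a * b^* = (b * a^*)^* by exact: H.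
by rewrite rmorphM /= conjCK mulrC.
Qed.

HB.instance Definition _ :=
  isHermitianSesquilinear.Build _ _ _ _ scalar_dot scalar_dot_herm.

Lemma scalar_dot_gt0 (x : C) : x != 0 -> 0 < scalar_dot x x.
Proof. by move=> x0; rewrite /scalar_dot mul_conjC_gt0. Qed.

HB.instance Definition _ := isDotProduct.Build _ _ scalar_dot scalar_dot_gt0.

Lemma scalar_dotxx (x : C) : scalar_dot x x = `|x| ^+ 2.
Proof. by rewrite /scalar_dot -normCK. Qed.

HB.instance Definition _ :=
  CompleteNormedModule_isHilbert.Build R (C) scalar_dotxx.

End ScalarHilbert.

Section UnconditionalSum.
Variables (R : realType) (X : choiceType).
Local Notation C := R[i].
Local Notation totally := (@summability.totally X).
Implicit Types (A B : {fset X}).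

Global Instance totally_proper : ProperFilter totally :=
  @summability.totally_filter X.

Lemma partial_sumE (V : zmodType) (f : X -> V) A :
  summability.partial_sum f A = \sum_(x <- A) f x.
Proof. by rewrite /summability.partial_sum big_seq_fsetE. Qed.

Lemma partial_sum_monotone (f : X -> C) A B :
  (forall x, 0 <= f x) -> (A `<=` B)%fset ->
  \sum_(x <- A) f x <= \sum_(x <- B) f x.
Proof.
move=> f0 AB; rewrite (big_fsetID _ (mem A) B) /=.
have -> : [fset x in B | x \in A]%fset = A.
  apply/fsetP => x; rewrite !inE /=; apply/andP/idP => [[]//|xA].
  by split=> //; exact: (fsubsetP AB).
by rewrite lerDl sumr_ge0.
Qed.

Lemma partial_sum_diff (f : X -> C) A B : (A `<=` B)%fset ->
  \sum_(x <- B) f x - \sum_(x <- A) f x = \sum_(x <- (B `\` A)%fset) f x.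
Proof.
move=> AB; rewrite (big_fsetID _ (mem A) B) /=.
have -> : [fset x in B | x \in A]%fset = A.
  apply/fsetP => x; rewrite !inE /=; apply/andP/idP => [[]//|xA].
  by split=> //; exact: (fsubsetP AB).
have -> : [fset x in B | x \notin A]%fset = (B `\` A)%fset.
  by apply/fsetP => x; rewrite !inE /= andbC.
by rewrite addrAC subrr add0r.
Qed.

Lemma abs_summable_cvg (f : X -> C) (M : C) :
  (forall A, \sum_(x <- A) `|f x| <= M) ->
  cvg (summability.partial_sum f @ totally).
Proof.
move=> fM; pose g A : R := \sum_(x <- A) complex.Re `|f x|.
have gE A : \sum_(x <- A) `|f x| = (g A)%:C.
  by rewrite raddf_sum; apply: eq_bigr => x _; exact: complex_normE.
have Mr : M = (complex.Re M)%:C.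
  have := fM fset0; rewrite big_seq_fset0 => M0.
  by rewrite RRe_real // ger0_real.
have gsup : has_sup (range g).
  split; first by exists (g fset0), fset0.
  by exists (complex.Re M) => _ [A _ <-]; rewrite -lecR -gE -Mr.
apply: cauchy_cvg; apply/cauchyP => e e0.
have er : e = (complex.Re e)%:C by rewrite RRe_real // ger0_real // ltW.
have e0' : 0 < complex.Re e by rewrite -ltcR -er.
have [_ [A0 _ <-] A0s] := sup_adherent e0' gsup.
exists (\sum_(x <- A0) f x), A0 => // A /= A0A.
rewrite -ball_normE /= partial_sumE distrC partial_sum_diff //.
apply: le_lt_trans (ler_norm_sum _ _ _) _; rewrite -partial_sum_diff // !gE.
rewrite -raddfB /= er ltcR ltrBlDr -ltrBlDl.
apply: le_lt_trans A0s; rewrite lerD2r.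
by apply: ub_le_sup; [case: gsup|exists A].
Qed.

Lemma sum_cvg (f : X -> C) (M : C) :
  (forall A, \sum_(x <- A) `|f x| <= M) ->
  summability.partial_sum f @ totally --> (summability.sum f : C).
Proof. by move=> /abs_summable_cvg. Qed.

Lemma cvg_complex_ge0 (T : Type) (F : set_system T) (FF : ProperFilter F)
    (u : T -> C) (l : C) :
  (\forall t \near F, 0 <= u t) -> u @ F --> l -> 0 <= l.
Proof.
move=> u0 ul; have nul : (fun t => `|u t| : C) @ F --> (`|l| : C).
  by apply: (@cvg_norm _ R[i]^o).
have ull : (fun t => `|u t| : C) @ F --> l.
  apply: cvg_trans ul; apply: near_eq_cvg; apply: filterS u0 => t /= ut0.
  by rewrite ger0_norm.
by rewrite (cvg_unique _ ull nul) //.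
Qed.

Lemma cvg_complex_le (T : Type) (F : set_system T) (FF : ProperFilter F)
    (u : T -> C) (l M : C) :
  (\forall t \near F, u t <= M) -> u @ F --> l -> l <= M.
Proof.
move=> uM ul; rewrite -subr_ge0.
apply: (@cvg_complex_ge0 _ F _ (fun t => M - u t)).
  by apply: filterS uM => t; rewrite subr_ge0.
by apply: (@cvgB _ C); [exact: cvg_cst|].
Qed.

Lemma sum_ge0_le (f : X -> C) (M : C) :
  (forall x, 0 <= f x) -> (forall A, \sum_(x <- A) f x <= M) ->
  summability.sum f <= M /\ forall A, \sum_(x <- A) f x <= summability.sum f.
Proof.
move=> f0 fM.
have fcv : summability.partial_sum f @ totally --> (summability.sum f : C).
  by apply: (@sum_cvg _ M) => A; under eq_bigr do rewrite ger0_norm //.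
split=> [|A].
  by apply: cvg_complex_le fcv; apply: nearW => A; rewrite partial_sumE.
rewrite -subr_ge0; apply: (@cvg_complex_ge0 _ totally _
  (fun B => summability.partial_sum f B - \sum_(x <- A) f x)).
  by exists A => // B /= AB; rewrite partial_sumE subr_ge0 partial_sum_monotone.
by apply: (@cvgB _ C); [exact: fcv|exact: cvg_cst].
Qed.

End UnconditionalSum.

Section HilbertTheory.
Variables (R : realType) (V : hilbertType R).
Implicit Types u v w : V.

Lemma hdot_norm_le u v : `|'[u, v]| <= `|u| * `|v|.
Proof.
rewrite -(@ler_pXn2r _ 2) ?nnegrE ?mulr_ge0 // exprMn -(hdotxx u) -(hdotxx v).
exact: dot_CauchySchwarz.
Qed.

Lemma hdot_norm_le_sqr u v : `|'[u, v]| <= `|u| ^+ 2 + `|v| ^+ 2.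
Proof.
apply: le_trans (hdot_norm_le u v) _; rewrite -subr_ge0.
rewrite (_ : _ - _ = (`|u| - `|v|) ^+ 2 + `|u| * `|v|); last by ring.
apply: addr_ge0; last exact: mulr_ge0.
by rewrite real_exprn_even_ge0 // rpredB // normr_real.
Qed.

Lemma sqr_normD_le u v : `|u + v| ^+ 2 <= 2 * (`|u| ^+ 2 + `|v| ^+ 2).
Proof.
apply: le_trans (_ : (`|u| + `|v|) ^+ 2 <= _).
  by rewrite ler_pXn2r ?nnegrE ?addr_ge0 // ler_normD.
rewrite -subr_ge0 (_ : _ - _ = (`|u| - `|v|) ^+ 2); last by ring.
by rewrite real_exprn_even_ge0 // rpredB // normr_real.
Qed.

Lemma hdotC u v : '[u, v] = '[v, u]^*.
Proof. by rewrite hermC expr0 mul1r. Qed.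

Lemma hdot_continuousl v : continuous (fun u : V => '[u, v]).
Proof.
move=> u; apply/(@cvgrPdist_le _ R[i]) => e e0.
have d0 : 0 < e / (`|v| + 1) by rewrite divr_gt0 // ltr_wpDl.
apply: filterS (nbhsx_ballx u _ d0) => w; rewrite -ball_normE /= => /ltW uw.
rewrite -linearBl /=; apply: le_trans (hdot_norm_le _ _) _.
rewrite -[leRHS](@divfK _ (`|v| + 1)) ?gt_eqF ?ltr_wpDl //.
by apply: ler_pM => //; rewrite lerDl.
Qed.

End HilbertTheory.

Section L2.
Variables (R : realType) (X : choiceType) (V : hilbertType R).
Local Notation C := R[i].
Implicit Types (A : {fset X}) (M : C).

Definition sqsummable (f : X -> V) :=
  exists M : C, forall A : {fset X}, \sum_(x <- A) `|f x| ^+ 2 <= M.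

Definition l2_pred : {pred X -> V} := [pred f | `[< sqsummable f >]].

Record l2 := L2 { l2_val :> X -> V ; _ : l2_val \in l2_pred }.

HB.instance Definition _ := [isSub for l2_val].
HB.instance Definition _ := [Choice of l2 by <:].

Lemma l2P (f : l2) : sqsummable f.
Proof. by case: f => f /= /asboolP. Qed.

Lemma l2_submod_closed : submod_closed l2_pred.
Proof.
split=> [|a f g /asboolP[M fM] /asboolP[N gN]]; apply/asboolP.
  by exists 0 => A; rewrite big1 // => x _; rewrite normr0 expr0n.
exists (2 * (`|a| ^+ 2 * M + N)) => A.
apply: (@le_trans _ _ (\sum_(x <- A) 2 * (`|a *: f x| ^+ 2 + `|g x| ^+ 2))).
  by apply: ler_sum => x _; exact: sqr_normD_le.
rewrite -mulr_sumr ler_pM2l // big_split /= lerD //.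
under eq_bigr do rewrite normrZ exprMn.
by rewrite -mulr_sumr ler_wpM2l ?exprn_ge0.
Qed.

HB.instance Definition _ :=
  GRing.isSubmodClosed.Build _ _ l2_pred l2_submod_closed.
HB.instance Definition _ := [SubChoice_isSubLmodule of l2 by <:].

Lemma l2_addE (f g : l2) x : (f + g) x = f x + g x. Proof. by []. Qed.
Lemma l2_subE (f g : l2) x : (f - g) x = f x - g x. Proof. by []. Qed.
Lemma l2_scaleE (a : C) (f : l2) x : (a *: f) x = a *: f x. Proof. by []. Qed.

Definition l2_dot (f g : l2) : C :=
  summability.sum (fun x => '[f x, g x] : C).

Lemma l2_dot_cvg (f g : l2) :
  (fun A => \sum_(x <- A) '[f x, g x]) @ @summability.totally X
    --> (l2_dot f g : C).
Proof.
have [[M fM] [N gN]] := (l2P f, l2P g).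
rewrite (_ : (fun A => _) = summability.partial_sum (fun x => '[f x, g x])).
  apply: (@sum_cvg _ _ _ (M + N)) => A; apply: le_trans (lerD (fM A) (gN A)).
  by rewrite -big_split /=; apply: ler_sum => x _; exact: hdot_norm_le_sqr.
by apply/funext => A; rewrite partial_sumE.
Qed.

Lemma l2_dot_unique (f g : l2) (l : C) :
  (fun A => \sum_(x <- A) '[f x, g x]) @ @summability.totally X --> l ->
  l2_dot f g = l.
Proof. by move=> h; exact: (cvg_unique (@norm_hausdorff _ C) (@l2_dot_cvg f g) h). Qed.

Lemma l2_dotC (f g : l2) : l2_dot f g = (l2_dot g f)^*.
Proof.
apply: l2_dot_unique.
rewrite (_ : (fun A => _) =
  (fun A => (\sum_(x <- A) '[g x, f x])^*)); last first.
  apply/funext => A; rewrite rmorph_sum; apply: eq_bigr => x _; exact: hdotC.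
have gf := @l2_dot_cvg g f.
apply/(@cvgrPdist_lt _ R[i]) => e e0; move/cvgrPdist_lt: gf => /(_ _ e0).
by apply: filterS => A; rewrite -rmorphB norm_conjC.
Qed.

Lemma l2_dot_linearl (h : l2) (a : C) (f g : l2) :
  l2_dot (a *: f + g) h = a * l2_dot f h + l2_dot g h.
Proof.
apply: l2_dot_unique.
rewrite (_ : (fun A => _) = (fun A => a * (\sum_(x <- A) '[f x, h x])
   + \sum_(x <- A) '[g x, h x])); last first.
  apply/funext => A; rewrite mulr_sumr -big_split /=; apply: eq_bigr => x _.
  by rewrite linearDl linearZl_LR.
apply: (@cvgD _ C); last exact: l2_dot_cvg.
by apply: (@cvgZr _ C); exact: l2_dot_cvg.
Qed.

Lemma l2_dot_bilinear : bilinear_for *%R (@conjC C \; *%R) l2_dot.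
Proof.
split=> [h a f g|h a f g]; first exact: l2_dot_linearl.
rewrite l2_dotC l2_dot_linearl (l2_dotC h f) (l2_dotC h g) /=.
by rewrite rmorphD rmorphM.
Qed.

HB.instance Definition _ :=
  bilinear_isBilinear.Build _ _ _ _ _ _ l2_dot l2_dot_bilinear.

Lemma l2_dot_herm (f g : l2) :
  l2_dot f g = (-1) ^+ false * (l2_dot g f)^*.
Proof. by rewrite expr0 mul1r -l2_dotC. Qed.

HB.instance Definition _ :=
  isHermitianSesquilinear.Build _ _ _ _ l2_dot l2_dot_herm.

Lemma l2_dotxx_sup (f : l2) (M : C) :
  (forall A, \sum_(x <- A) `|f x| ^+ 2 <= M) ->
  l2_dot f f <= M /\ forall A, \sum_(x <- A) `|f x| ^+ 2 <= l2_dot f f.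
Proof.
move=> fM; have ff : (fun x => '[f x, f x] : C) = (fun x => `|f x| ^+ 2).
  by apply/funext => x; rewrite hdotxx.
by rewrite /l2_dot ff; apply: sum_ge0_le => // x; rewrite exprn_ge0.
Qed.

Lemma l2_dotxx_ge (f : l2) A : \sum_(x <- A) `|f x| ^+ 2 <= l2_dot f f.
Proof. by have [M /l2_dotxx_sup[_]] := l2P f. Qed.

Lemma l2_dotxx_ge1 (f : l2) x : `|f x| ^+ 2 <= l2_dot f f.
Proof. by have := l2_dotxx_ge f [fset x]%fset; rewrite big_seq_fset1. Qed.

Lemma l2_dot_gt0 (f : l2) : f != 0 -> 0 < l2_dot f f.
Proof.
move=> f0; have [x fx] : exists x, f x != 0.
  apply: contrapT => fx0; case/eqP: f0; apply/val_inj/funext => x.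
  by apply/eqP; apply: contrapT => /negP fx; apply: fx0; exists x.
by apply: lt_le_trans (l2_dotxx_ge1 f x); rewrite exprn_gt0 // normr_gt0.
Qed.

HB.instance Definition _ := isDotProduct.Build _ _ l2_dot l2_dot_gt0.

Definition l2_norm (f : l2) : C := sqrtC (l2_dot f f).

Lemma l2_normD f g : l2_norm (f + g) <= l2_norm f + l2_norm g.
Proof. exact: dot_triangle. Qed.

Lemma l2_normZ (a : C) f : l2_norm (a *: f) = `|a| * l2_norm f.
Proof.
rewrite /l2_norm dnormZ sqrtCM ?nnegrE ?exprn_ge0 ?dnorm_ge0 //.
by rewrite sqrCK.
Qed.

Lemma l2_norm0_eq0 f : l2_norm f = 0 -> f = 0.
Proof. by move/eqP; rewrite sqrt_dnorm_eq0 => /eqP. Qed.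

HB.instance Definition _ :=
  Lmodule_isNormed.Build C l2 l2_normD l2_normZ l2_norm0_eq0.

Lemma l2_dotxx (f : l2) : l2_dot f f = `|f| ^+ 2.
Proof. by rewrite -[X in _ = X ^+ 2]/(l2_norm f) sqrtCK. Qed.

Lemma l2_norm_ge A (f : l2) : \sum_(x <- A) `|f x| ^+ 2 <= `|f| ^+ 2.
Proof. by rewrite -l2_dotxx l2_dotxx_ge. Qed.

Lemma l2_norm_le (f : l2) (e : C) : 0 <= e ->
  (forall A, \sum_(x <- A) `|f x| ^+ 2 <= e ^+ 2) -> `|f| <= e.
Proof.
move=> e0 /l2_dotxx_sup[fe _].
by rewrite -(@ler_pXn2r _ 2) ?nnegrE // -l2_dotxx.
Qed.

Lemma l2_eval_le (f : l2) x : `|f x| <= `|f|.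
Proof.
rewrite -(@ler_pXn2r _ 2) ?nnegrE //.
by have := l2_norm_ge [fset x]%fset f; rewrite big_seq_fset1.
Qed.

Lemma l2_cauchy_cvg (F : set_system l2) : ProperFilter F -> cauchy F -> cvg F.
Proof.
move=> FF /cauchyP Fc.
have evalc x : exists l : V, (fun f : l2 => f x) @ F --> l.
  apply/cvg_ex; apply: (@cauchy_cvg V ((fun f : l2 => f x) @ F)).
  apply/cauchyP => e e0; have [f Ff] := Fc e e0.
  exists (f x); apply: (@filterS _ F _ (ball f e)) Ff => g.
  rewrite -!ball_normE /=; apply: le_lt_trans.
  by rewrite -l2_subE; exact: l2_eval_le.
have [g Fg] := choice evalc.
have key (f : l2) e : 0 < e -> F (ball f e) ->
    forall A, \sum_(x <- A) `|g x - f x| ^+ 2 <= e ^+ 2.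
  move=> e0 Ff A.
  apply: (@cvg_complex_le _ _ F _ (fun h : l2 => \sum_(x <- A) `|h x - f x| ^+ 2)).
    apply: filterS Ff => h; rewrite -ball_normE /= distrC => /ltW fh.
    apply: le_trans (l2_norm_ge A (h - f)) _.
    by rewrite ler_pXn2r ?nnegrE // ltW.
  have cvg1 x : (fun h : l2 => `|h x - f x| ^+ 2 : C) @ F --> (`|g x - f x| ^+ 2 : C).
    have h1 : (fun h : l2 => `|h x - f x| : C) @ F --> (`|g x - f x| : C).
      by apply: (@cvg_norm _ V); apply: cvgB; [exact: Fg|exact: cvg_cst].
    by apply: (@cvgM C).
  elim: (enum_fset A) => [|x s IHs].
    rewrite big_nil; under eq_fun do rewrite big_nil; exact: cvg_cst.
  rewrite big_cons; under eq_fun do rewrite big_cons.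
  by apply: (@cvgD _ C); [exact: cvg1|exact: IHs].
have g_l2 : g \in l2_pred.
  have [f Ff] := Fc 1 ltr01; have gf := key f 1 ltr01 Ff.
  have : (g - f) \in l2_pred by apply/asboolP; exists (1 ^+ 2).
  move=> gf2; have -> : g = (g - f) + f by rewrite subrK.
  by apply: rpredD => //; case: (f).
apply/cvg_ex; exists (L2 g_l2); apply/cvgrPdist_le => e e0.
have e2 : 0 < e / 2 by rewrite divr_gt0.
have [f Ff] := Fc _ e2; apply: filterS (Ff) => h; rewrite -ball_normE /= => fh.
rewrite -(subrKA f) [leRHS]splitr; apply: le_trans (ler_normD _ _) _.
apply: lerD (ltW fh); apply: l2_norm_le; first exact: ltW.
exact: key.
Qed.

HB.instance Definition _ := Uniform_isComplete.Build l2 l2_cauchy_cvg.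
HB.instance Definition _ :=
  CompleteNormedModule_isHilbert.Build R l2 l2_dotxx.

End L2.

Section ClosedSubspace.
Variables (R : realType) (V : hilbertType R).
Local Notation C := R[i].

Record closed_subspace := ClosedSubspace {
  subspace_set :> set V ;
  subspace0 : subspace_set 0 ;
  subspaceP : forall (a : C) (u v : V),
    subspace_set u -> subspace_set v -> subspace_set (a *: u + v) ;
  subspace_closed : closed subspace_set }.

Variable W : closed_subspace.

Definition sub_pred : {pred V} := [pred v | `[< subspace_set W v >]].

(* The closed subspace [W] as a Hilbert space in its own right *)
Record sub_hilbert := SubHilbert {
  sub_val : V ; _ : sub_val \in sub_pred }.

HB.instance Definition _ := [isSub for sub_val].
HB.instance Definition _ := [Choice of sub_hilbert by <:].

Lemma sub_submod_closed : submod_closed sub_pred.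
Proof.
split=> [|a u v /asboolP Wu /asboolP Wv]; apply/asboolP; first exact: subspace0.
exact: subspaceP.
Qed.

HB.instance Definition _ :=
  GRing.isSubmodClosed.Build _ _ sub_pred sub_submod_closed.
HB.instance Definition _ := [SubChoice_isSubLmodule of sub_hilbert by <:].

Definition sub_dot (u v : sub_hilbert) : C := '[val u, val v].

Lemma sub_dot_bilinear :
  bilinear_for *%R (@conjC C \; *%R) sub_dot.
Proof.
split=> [w a u v|w a u v]; rewrite /sub_dot.
  by rewrite /= linearDl linearZl_LR.
by rewrite /= linearDr linearZr_LR.
Qed.

HB.instance Definition _ :=
  bilinear_isBilinear.Build _ _ _ _ _ _ sub_dot sub_dot_bilinear.

Lemma sub_dot_herm (u v : sub_hilbert) :
  sub_dot u v = (-1) ^+ false * (sub_dot v u)^*.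
Proof. by rewrite expr0 mul1r; exact: hdotC. Qed.

HB.instance Definition _ :=
  isHermitianSesquilinear.Build _ _ _ _ sub_dot sub_dot_herm.

Lemma sub_dot_gt0 (u : sub_hilbert) : u != 0 -> 0 < sub_dot u u.
Proof.
move=> u0; rewrite /sub_dot hdotxx exprn_gt0 // normr_gt0.
by apply: contra_neq u0 => u0; exact: val_inj.
Qed.

HB.instance Definition _ := isDotProduct.Build _ _ sub_dot sub_dot_gt0.

Definition sub_norm (u : sub_hilbert) : C := `|val u|.

Lemma sub_normD u v :
  sub_norm (u + v) <= sub_norm u + sub_norm v.
Proof. exact: ler_normD. Qed.

Lemma sub_normZ (a : C) u : sub_norm (a *: u) = `|a| * sub_norm u.
Proof. exact: normrZ. Qed.

Lemma sub_norm0_eq0 u : sub_norm u = 0 -> u = 0.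
Proof. by move/normr0_eq0 => u0; exact: val_inj. Qed.

HB.instance Definition _ := Lmodule_isNormed.Build C sub_hilbert
  sub_normD sub_normZ sub_norm0_eq0.

Lemma sub_dotxx (u : sub_hilbert) : sub_dot u u = `|u| ^+ 2.
Proof. exact: hdotxx. Qed.

Lemma sub_cauchy_cvg (F : set_system sub_hilbert) :
  ProperFilter F -> cauchy F -> cvg F.
Proof.
move=> FF /cauchyP Fc.
have [l Fl] : exists l : V, (val : sub_hilbert -> V) @ F --> l.
  apply/cvg_ex; apply: (@cauchy_cvg V ((val : sub_hilbert -> V) @ F)).
  apply/cauchyP => e e0; have [u Fu] := Fc e e0.
  exists (val u); apply: (@filterS _ F _ (ball u e)) Fu => v.
  by rewrite -!ball_normE.
have Wl : l \in sub_pred.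
  apply/asboolP; apply: (closed_cvg _ (@subspace_closed W)) Fl.
  by apply: nearW => -[u /= /asboolP].
apply/cvg_ex; exists (SubHilbert Wl); apply/cvgrPdist_lt => e e0.
by move/cvgrPdist_lt: Fl => /(_ _ e0).
Qed.

HB.instance Definition _ := Uniform_isComplete.Build sub_hilbert sub_cauchy_cvg.
HB.instance Definition _ :=
  CompleteNormedModule_isHilbert.Build R sub_hilbert sub_dotxx.

End ClosedSubspace.

Section Constructions.
Variables (R : realType) (V : hilbertType R).
Local Notation C := R[i].

Section Orthogonal.
Variable A : set V.

Definition orth_set : set V := [set v | forall u, A u -> '[v, u] = 0].

Lemma orth_set0 : orth_set 0.
Proof. by move=> u _; rewrite linear0l. Qed.

Lemma orth_setP (a : C) (u v : V) :
  orth_set u -> orth_set v -> orth_set (a *: u + v).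
Proof.
by move=> Au Av w Aw; rewrite linearDl linearZl_LR /= Au // Av // mulr0 addr0.
Qed.

Lemma orth_set_closed : closed orth_set.
Proof.
rewrite (_ : orth_set = \bigcap_(u in A) ((fun v : V => '[v, u]) @^-1` [set 0])).
  apply: closed_bigI => u _; apply: (@preimage_closed V C (fun v : V => '[v, u])).
    by move=> v _; exact: hdot_continuousl.
  exact/accessible_closed_set1/hausdorff_accessible/(@norm_hausdorff _ C).
by apply/seteqP; split=> v.
Qed.

Definition orth : closed_subspace V :=
  ClosedSubspace orth_set0 orth_setP orth_set_closed.

End Orthogonal.

Section Span.
Variable A : set V.

Definition lin_span : set V := [set v | exists (n : nat) (a : 'I_n -> C) (u : 'I_n -> V),
  (forall i, A (u i)) /\ v = \sum_(i < n) a i *: u i].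

Lemma lin_span0 : lin_span 0.
Proof.
exists 0%N, (fun=> 0), (fun=> 0); split; first by case.
by rewrite big_ord0.
Qed.

Lemma lin_spanP (a : C) (u v : V) : lin_span u -> lin_span v -> lin_span (a *: u + v).
Proof.
move=> [n [b [x [Ax ->]]]] [m [c [y [Ay ->]]]].
exists (n + m)%N,
  (fun i => match fintype.split i with inl j => a * b j | inr j => c j end),
  (fun i => match fintype.split i with inl j => x j | inr j => y j end).
split=> [i|]; first by case: (fintype.split i).
rewrite big_split_ord /= scaler_sumr; congr (_ + _); apply: eq_bigr => i _.
  by rewrite (unsplitK (inl i)) scalerA.
by rewrite (unsplitK (inr i)).
Qed.

Lemma closure_span0 : closure lin_span 0.
Proof. exact/subset_closure/lin_span0. Qed.

Lemma closure_spanP (a : C) (u v : V) :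
  closure lin_span u -> closure lin_span v -> closure lin_span (a *: u + v).
Proof.
move=> Au Av B.
have /(_ (u, v)) cont : continuous (fun p : V * V => a *: p.1 + p.2).
  move=> p; apply: cvgD; last exact: cvg_snd.
  by apply: cvgZl_tmp; exact: cvg_fst.
move=> /cont[[B1 B2] /= [uB1 vB2] B12].
have [x [Ax B1x]] := Au _ uB1; have [y [Ay B2y]] := Av _ vB2.
exists (a *: x + y); split; first exact: lin_spanP.
exact: (B12 (x, y)).
Qed.

Definition closed_span : closed_subspace V :=
  ClosedSubspace closure_span0 closure_spanP (@closed_closure _ lin_span).

End Span.
End Constructions.

Section Operators.
Variables (R : realType) (V W : hilbertType R).
Local Notation C := R[i].

Definition bounded_linear (A : V -> W) := linear A /\ continuous A.

(* The Hilbert-space adjoint, unique when it exists; it exists for every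
   bounded linear [A], and [adjoint A] is a junk value otherwise. *)
Definition adjoint (A : V -> W) : W -> V :=
  xget (fun=> 0) [set B : W -> V | forall x y, '[A x, y] = '[x, B y]].

Definition has_dim (L : set V) (d : nat) := exists b : 'I_d -> V,
  [/\ forall i, L (b i),
      forall a : 'I_d -> C, \sum_(i < d) a i *: b i = 0 -> forall i, a i = 0 &
      L `<=` lin_span (range b)].

(* The dimension of the span of [L]; 0 if [L] has infinite rank *)
Definition dim (L : set V) : nat := xget 0%N [set d | has_dim L d].

End Operators.

Section Operators2.
Variables (R : realType) (V : hilbertType R).
Local Notation C := R[i].
Implicit Types A B : V -> V.

Definition positive_op A := forall x, 0 <= '[A x, x].

(* The positive square root of a positive bounded operator; over the complex
   field [positive_op] entails self-adjointness. *)
Definition sqrt_op A : V -> V := xget (fun=> 0)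
  [set B : V -> V | [/\ bounded_linear B, positive_op B & B \o B = A]].

Definition finite_rank A := exists d, has_dim (range A) d.

Definition op_rank A : nat := dim (range A).

Definition orthonormal_basis (I : choiceType) (b : I -> V) :=
  (forall i j, '[b i, b j] = (i == j)%:R) /\
  closure (lin_span (range b)) = setT.

(* The sum of the diagonal entries converges unconditionally to the same value
   in every orthonormal basis, i.e. [A] is trace class with trace [t]. *)
Definition has_trace A (t : C) :=
  forall (I : choiceType) (b : I -> V), orthonormal_basis b ->
    summability.partial_sum (fun i => '[A (b i), b i]) @ summability.totally
      --> (t : C).

Definition op_trace A : C := xget 0 [set t | has_trace A t].

Definition proj_sub (L : closed_subspace V) (v : V) : sub_hilbert L :=
  xget 0 [set p | forall w : sub_hilbert L, '[v - val p, val w] = 0].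

Definition orth_proj (L : closed_subspace V) (v : V) : V := val (proj_sub L v).

End Operators2.

Section L2Operators.
Variables (R : realType) (X : choiceType) (V : hilbertType R).
Local Notation C := R[i].
Implicit Types f : l2 X V.

(* [to_l2 f] is [f] as an element of l2, and 0 if [f] is not square-summable *)
Definition to_l2 (f : X -> V) : l2 X V := insubd (0 : l2 X V) f.

Lemma to_l2E (f : X -> V) : sqsummable f -> to_l2 f = f :> (X -> V).
Proof. by move=> fP; rewrite /to_l2 -[LHS]/(val _) insubdK //; exact/asboolP. Qed.

Definition coord_proj (D : pred X) f : l2 X V :=
  to_l2 (fun x => if D x then f x else 0).

Lemma coord_projE D f x : coord_proj D f x = if D x then f x else 0.
Proof.
rewrite /coord_proj to_l2E //; have [M fM] := l2P f; exists M => A.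
apply: le_trans (fM A); apply: ler_sum => y _.
by case: ifP => // _; rewrite normr0 expr0n exprn_ge0.
Qed.

Definition coord_mul (c : X -> C) f : l2 X V := to_l2 (fun x => c x *: f x).

Lemma coord_mulE c f : (forall x, `|c x| = 1) ->
  forall x, coord_mul c f x = c x *: f x.
Proof.
move=> c1 x; rewrite /coord_mul to_l2E //; have [M fM] := l2P f; exists M => A.
apply: le_trans (fM A); apply: ler_sum => y _.
by rewrite normrZ c1 mul1r.
Qed.

End L2Operators.

Section Tuples.
Variables (R : realType) (k : nat) (n : 'I_k -> nat).
Local Notation C := R[i].

(* A multiword (a_1, ..., a_k), with a_i a word on n_i letters.  The full Fock
   space F^2(H_{n_i}) is l2 (seq 'I_(n i)), with e^i_a the indicator of a; the
   Hilbert tensor product of the l2 (X_i) is l2 of the product of the X_i, the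
   vector e^1_{a_1} (x) ... (x) e^k_{a_k} being the indicator of the multiword,
   called [unit_vec] below.  In the same way the tensor product of [fock] with
   a Hilbert space D is l2 words D. *)
Definition words := {dffun forall i : 'I_k, seq 'I_(n i)}.

Definition level (q : 'I_k -> nat) : pred words :=
  fun a => [forall i, size (a i) == q i].

Definition upto (q : 'I_k -> nat) : pred words :=
  fun a => [forall i, size (a i) <= q i]%N.

Definition fock : hilbertType R := l2 words R[i].

(* P_{<= (q_1, ..., q_k)} and P^(1)_{q_1} (x) ... (x) P^(k)_{q_k} *)
Definition proj_upto (q : 'I_k -> nat) : fock -> fock :=
  @coord_proj _ _ R[i] (upto q).

Definition proj_level (q : 'I_k -> nat) : fock -> fock :=
  @coord_proj _ _ R[i] (level q).

Section Tuple.
Variables (H : hilbertType R) (T : forall i : 'I_k, 'I_(n i) -> H -> H).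

Definition Phi (i : 'I_k) (Y : H -> H) : H -> H :=
  fun h => \sum_(j < n i) T j (Y (adjoint (T j) h)).

(* (id - Phi_1)^(p_1) o ... o (id - Phi_k)^(p_k) applied to the identity, with
   p_i in {0, 1} *)
Definition defect_of (p : 'I_k -> bool) : H -> H :=
  foldr (fun i Y => if p i then fun h => Y h - Phi i Y h else Y) id (enum 'I_k).

Definition defect : H -> H := defect_of (fun=> true).

Definition in_polyball :=
  [/\ forall (i : 'I_k) (j : 'I_(n i)), bounded_linear (T j),
      forall (s t : 'I_k) (j : 'I_(n s)) (l : 'I_(n t)),
        s != t -> T j \o T l = T l \o T j &
      forall p, positive_op (defect_of p)].

Definition word_op (i : 'I_k) (w : seq 'I_(n i)) : H -> H :=
  foldr (fun j Y => T j \o Y) id w.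

(* T_{1,a_1} ... T_{k,a_k} h *)
Definition words_op (a : words) (h : H) : H :=
  foldr (fun i => word_op (a i)) h (enum 'I_k).

(* T_{1,a_1}^* ... T_{k,a_k}^* h *)
Definition words_adj (a : words) (h : H) : H :=
  foldr (fun i => adjoint (word_op (a i))) h (enum 'I_k).

(* M_q(T) *)
Definition euler_space (q : 'I_k -> nat) : set H :=
  lin_span [set v | exists a h, [/\ upto q a, range defect h & v = words_op a h]].

(* chi(T) = c : the limit is c along every increasing cofinal sequence of Z_+^k *)
Definition is_euler_char (c : C) :=
  forall q : nat -> 'I_k -> nat,
    (forall m i, q m i <= q m.+1 i)%N ->
    (forall p : 'I_k -> nat, exists m, forall i, (p i <= q m i)%N) ->
    (fun m => (dim (euler_space (q m)))%:R /
       (\prod_(i < k) \sum_(j < (q m i).+1) n i ^ j)%N%:R : C) @ \oo --> c.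

Definition defect_space : closed_subspace H := closed_span (range defect).

(* K_T.  For T in the regular polyball with finite-rank defect, neither [insubd]
   nor [to_l2] falls back on its default value: the range of the square root lies
   in [defect_space], and the family is square-summable. *)
Definition berezin (h : H) : l2 words (sub_hilbert defect_space) :=
  to_l2 (fun b => insubd (0 : sub_hilbert defect_space) (sqrt_op defect (words_adj b h))).

Definition curv_term (q : 'I_k -> nat) : C :=
  op_trace (adjoint berezin \o @coord_proj _ _ _ (level q) \o berezin) /
  op_trace (proj_level q).

(* curv(T) = c *)
Definition is_curvature (c : C) :=
  (fun m => ('C(m + k, k)%:R)^-1 *
     \sum_(q : {ffun 'I_k -> 'I_m.+1} | (\sum_(i < k) q i <= m)%N)
        curv_term (fun i => q i) : C) @ \oo --> c.

End Tuple.

Section Fock.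

Definition unit_vec (a : words) : fock :=
  to_l2 (fun b : words => (b == a)%:R : R[i]).

Definition prepend (i : 'I_k) (j : 'I_(n i)) (a : words) : words :=
  finfun (dfwith a (j :: a i)).

Definition strip (i : 'I_k) (a : words) : words :=
  finfun (dfwith a (behead (a i))).

(* S_{i,j} is determined by S_{i,j} e_a = e_{g_j a}, a prefixed on the i-th
   coordinate: see [creation_unit_vec]. *)
Definition creation (i : 'I_k) (j : 'I_(n i)) (f : fock) : fock :=
  to_l2 (fun a : words => if ohead (a i) == Some j then f (strip i a) else 0).

(* The gauge unitary U(z), for z in the torus *)
Definition gauge (z : 'I_k -> C) : fock -> fock :=
  coord_mul (fun a : words => \prod_(i < k) z i ^+ size (a i)).

Lemma unit_vecE (a b : words) : unit_vec a b = (b == a)%:R.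
Proof.
rewrite /unit_vec to_l2E //; exists 1 => A.
have [aA|aA] := boolP (a \in A); last first.
  rewrite big_seq big1 // => x xA; case: eqP => [xa|]; last first.
    by rewrite normr0 expr0n.
  by move: aA; rewrite -xa xA.
rewrite (big_fsetD1 a) //= eqxx normr1 expr1n big_seq big1 ?addr0 // => x.
by rewrite !inE => /andP[/negPf-> _]; rewrite normr0 expr0n.
Qed.

Lemma prepend_head (i : 'I_k) (j : 'I_(n i)) (a : words) :
  ohead (prepend j a i) = Some j.
Proof. by rewrite ffunE dfwith_in. Qed.

Lemma prependK (i : 'I_k) (j : 'I_(n i)) (a : words) :
  strip i (prepend j a) = a.
Proof.
apply/ffunP => s; rewrite ffunE; have [<-|si] := eqVneq i s.
  by rewrite dfwith_in ffunE dfwith_in.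
by rewrite dfwith_out // ffunE dfwith_out.
Qed.

Lemma stripK (i : 'I_k) (j : 'I_(n i)) (a : words) :
  ohead (a i) = Some j -> prepend j (strip i a) = a.
Proof.
move=> aj; apply/ffunP => s; rewrite ffunE; have [<-|si] := eqVneq i s.
  by rewrite dfwith_in ffunE dfwith_in; case: (a i) aj => //= l w [->].
by rewrite dfwith_out // ffunE dfwith_out.
Qed.

Lemma creationE (i : 'I_k) (j : 'I_(n i)) (f : fock) (a : words) :
  creation j f a = if ohead (a i) == Some j then f (strip i a) else 0.
Proof.
rewrite /creation to_l2E //; have [M fM] := l2P f; exists M => A.
pose P (b : words) := ohead (b i) == Some j.
pose B := [fset b in A | P b]%fset.
have BP b : b \in B -> ohead (b i) = Some j.
  by rewrite /B !inE => /andP[_ /eqP].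
apply: le_trans (fM [fset strip i b | b in B]%fset).
rewrite big_imfset /=; last first.
  by move=> b c /BP bj /BP cj bc; rewrite -(stripK bj) bc stripK.
rewrite (big_fsetID _ P A) /= -[leRHS]addr0; apply: lerD.
  rewrite big_seq [leRHS]big_seq; apply: ler_sum => b bB.
  by rewrite (BP b bB) eqxx.
rewrite big_seq big1 // => b.
by rewrite !inE /P => /andP[_ /negPf->]; rewrite normr0 expr0n.
Qed.

Lemma creation_unit_vec (i : 'I_k) (j : 'I_(n i)) (a : words) :
  creation j (unit_vec a) = unit_vec (prepend j a).
Proof.
apply/val_inj/funext => b /=; rewrite creationE !unit_vecE.
have [bj|bj] := eqVneq (ohead (b i)) (Some j).
  congr (nat_of_bool _)%:R; apply/eqP/eqP => [<-|->]; first by rewrite stripK.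
  exact: prependK.
case: eqP => // ba; move: bj; rewrite ba prepend_head eqxx //.
Qed.

Lemma gaugeE (z : 'I_k -> C) (f : fock) (a : words) :
  (forall i, `|z i| = 1) ->
  gauge z f a = (\prod_(i < k) z i ^+ size (a i)) * f a.
Proof.
move=> z1; rewrite /gauge coord_mulE // => b.
rewrite normr_prod big1 // => i _.
by rewrite normrX z1 expr1n.
Qed.

Definition creation_invariant (M : set fock) :=
  forall (i : 'I_k) (j : 'I_(n i)) f, M f -> M (creation j f).

Definition graded (M : set fock) :=
  forall z : 'I_k -> C, (forall i, `|z i| = 1) ->
  forall f, M f -> M (gauge z f).

(* The tuple P_{M^perp} S |_{M^perp} on the Hilbert space M^perp *)
Definition compression (M : closed_subspace fock) (i : 'I_k) (j : 'I_(n i))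
    (x : sub_hilbert (orth M)) : sub_hilbert (orth M) :=
  proj_sub (orth M) (creation j (val x)).

End Fock.
End Tuples.

Arguments proj_upto {R k n} q.
Arguments compression {R k n} M i j x.

(* lim_{q_1} ... lim_{q_k} u(q_1, ..., q_k) = l, the limit in q_k being taken
   first; all the inner limits are required to exist. *)
Fixpoint iter_lim (R : realType) (k : nat) :
    (('I_k -> nat) -> R[i]) -> R[i] -> Prop :=
  match k with
  | 0 => fun u l => forall q, u q = l
  | k'.+1 => fun u l => exists g : nat -> R[i],
      (forall q0, iter_lim (fun q => u (fun i => oapp q q0 (unlift ord0 i))) (g q0)) /\
      g @ \oo --> (l : R[i])
  end.

(* Main.v *)
Require Import Defs.
From mathcomp Require Import all_boot all_order all_algebra sesquilinear.
From mathcomp Require Import complex finmap.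
From mathcomp Require Import boolp classical_sets functions reals topology.
From mathcomp Require Import normedtype sequences.
From mathcomp Require Import ring lra zify.

Set Implicit Arguments.
Unset Strict Implicit.
Unset Printing Implicit Defensive.

Import Order.TTheory GRing.Theory Num.Theory.
Import numFieldNormedType.Exports.

Local Open Scope classical_set_scope.
Local Open Scope complex_scope.
Local Open Scope ring_scope.

(** Let [N] be the orthogonal complement of [M], [P] the projection onto [N]
    and [mass a = |P e_a|^2] for each multiword [a]. Everything in the theorem is
    an average of [mass].

    Invariance of [M] gives [P S_{i,j} P = P S_{i,j}], and creation operators
    are isometric, so [mass] does not increase when a letter is prefixed
    ([mass_prepend]). As each word of a level is uniquely a letter followed by
    a word of the preceding level, the average of [mass] over the words of
    multidegree exactly [q] is antitone in [q] ([level_average_antitone]); let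
    [l] be its infimum. The average over the words of multidegree at most [q]
    is obtained from it by averaging along each coordinate in turn with weights
    [n_i ^ j] ([averages_levels]), and such averaging keeps antitone functions
    antitone and does not change their infimum ([average_antitone],
    [average_glb]). An antitone function tends to its infimum both along
    iterated limits ([antitone_iter_lim]) and along increasing cofinal sequences
    ([antitone_cofinal_cvg]), and so do its averages over growing simplices,
    because the multi-indices with a small entry are a vanishing proportion of
    the simplex ([simplex_average_cvg]).

    It remains to recognise these averages. The trace of [P P_{<= q}] is the sum
    of [mass] over the words of degree at most [q]. Since [M] is graded, it is
    preserved by the projections onto given degrees, so [P] commutes with
    [P_{<= q}] ([proj_upto_orth_proj]); the product is then a projection of
    finite rank, whose rank equals its trace, and its range is the space whose
    dimension defines the Euler characteristic ([dim_mass]). For the curvature,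
    the defect of the compression is [P P_0] restricted to [N], with [P_0] the
    projection onto the empty multiword ([defectE]). By gradedness it is a
    projection, hence its own square root ([sqrt_defect]), so that the Berezin
    kernel is the inclusion of [N] in the Fock space, and the level traces are
    the sums of [mass] over the levels ([trace_berezin_level]). *)

(** * Orthogonal projections in a Hilbert space *)

Section HilbertGeometry.
Variables (R : realType) (V : hilbertType R).
Local Notation C := R[i].
Implicit Types u v w : V.

Definition sqnorm v : R := complex.Re (`|v| ^+ 2).

Lemma sqnormE v : (sqnorm v)%:C = '[v, v].
Proof. by rewrite /sqnorm hdotxx RRe_real // ger0_real // exprn_ge0. Qed.

Lemma sqnorm_ge0 v : 0 <= sqnorm v.
Proof. by rewrite -lecR sqnormE hdotxx exprn_ge0. Qed.

Lemma sqnorm_norm_le v (e : R) : 0 <= e -> (sqnorm v <= e ^+ 2) = (`|v| <= e%:C).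
Proof.
move=> e0; rewrite -lecR sqnormE hdotxx rmorphXn /= ler_pXn2r ?nnegrE //.
by rewrite lecR.
Qed.

Lemma hdotDl u v w : '[u + v, w] = '[u, w] + '[v, w]. Proof. exact: linearDl. Qed.
Lemma hdotBl u v w : '[u - v, w] = '[u, w] - '[v, w]. Proof. exact: linearBl. Qed.
Lemma hdotDr u v w : '[w, u + v] = '[w, u] + '[w, v]. Proof. exact: linearDr. Qed.
Lemma hdotBr u v w : '[w, u - v] = '[w, u] - '[w, v]. Proof. exact: linearBr. Qed.
Lemma hdot0l v : '[0, v] = 0. Proof. exact: linear0l. Qed.
Lemma hdot0r v : '[v, 0] = 0. Proof. exact: linear0r. Qed.
Lemma hdotZl (a : C) u v : '[a *: u, v] = a * '[u, v].
Proof. exact: linearZl_LR. Qed.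
Lemma hdotZr (a : C) u v : '[u, a *: v] = a^* * '[u, v].
Proof. exact: linearZr_LR. Qed.

Lemma parallelogram u v :
  sqnorm (u - v) + sqnorm (u + v) = 2 * sqnorm u + 2 * sqnorm v.
Proof.
apply: complexI; rewrite !rmorphD !rmorphM /= !sqnormE.
by rewrite !(hdotBl, hdotBr, hdotDl, hdotDr) rmorph_nat; ring.
Qed.

Lemma sqnormZ (a : C) u : (sqnorm (a *: u))%:C = a * a^* * (sqnorm u)%:C.
Proof. by rewrite !sqnormE hdotZl hdotZr mulrA. Qed.

Lemma hdot_suml (J : Type) (s : seq J) (f : J -> V) v :
  '[\sum_(j <- s) f j, v] = \sum_(j <- s) '[f j, v].
Proof. exact: (big_morph _ (fun x y => hdotDl x y v) (hdot0l v)). Qed.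

Lemma hdot_eq0 v : ('[v, v] == 0) = (v == 0).
Proof. by rewrite hdotxx expf_eq0 /= normr_eq0. Qed.

Lemma hdot_inj u v : (forall w, '[u, w] = '[v, w]) -> u = v.
Proof.
move=> uv; apply/eqP; rewrite -subr_eq0 -hdot_eq0; apply/eqP.
by rewrite hdotBl uv subrr.
Qed.

End HilbertGeometry.

Section Projection.
Variables (R : realType) (V : hilbertType R) (L : closed_subspace V).
Local Notation C := R[i].
Implicit Types u v w p : V.

Lemma subspaceD u v : subspace_set L u -> subspace_set L v ->
  subspace_set L (u + v).
Proof. by move=> Lu Lv; rewrite -[u]scale1r; exact: subspaceP. Qed.
Lemma subspaceZ (a : C) u : subspace_set L u -> subspace_set L (a *: u).
Proof. by move=> Lu; rewrite -[_ *: _]addr0; apply: subspaceP => //;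
  exact: subspace0. Qed.
Lemma subspaceB u v : subspace_set L u -> subspace_set L v ->
  subspace_set L (u - v).
Proof. by move=> Lu Lv; apply: subspaceD => //; rewrite -scaleN1r;
  exact: subspaceZ. Qed.
Let dist v : set R := [set sqnorm (v - w) | w in (L : set V)].
Let near_min v (e : R) : set V :=
  [set w | subspace_set L w /\ sqnorm (v - w) <= inf (dist v) + e].

Let dist_inf v : has_inf (dist v).
Proof.
split; first by exists (sqnorm (v - 0)), 0 => //; exact: subspace0.
by exists 0 => _ [w _ <-]; exact: sqnorm_ge0.
Qed.

Let dist_le v w : subspace_set L w -> inf (dist v) <= sqnorm (v - w).
Proof. by move=> Lw; apply: ge_inf; [case: (dist_inf v)|exists w]. Qed.

(** The midpoint of two near-minimisers is in [L], so it is not closer to [v]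
    than the infimum, and the parallelogram law bounds their difference. *)
Let near_min_diam v e w x : near_min v e w -> near_min v e x ->
  sqnorm (w - x) <= 4 * e.
Proof.
move=> [Lw wd] [Lx xd].
have := parallelogram (v - x) (v - w).
have -> : v - x - (v - w) = w - x by rewrite opprB addrC subrKA.
have Lm : subspace_set L (2^-1 *: (x + w)) by apply/subspaceZ/subspaceD.
have -> : v - x + (v - w) = 2 *: (v - 2^-1 *: (x + w)).
  rewrite scalerBr scalerA divff ?pnatr_eq0 // scale1r scaler_nat mulr2n.
  by rewrite opprD addrACA.
have := dist_le v Lm; set z := v - _ *: _ => hz.
have -> : sqnorm (2 *: z) = 4 * sqnorm z.
  apply: complexI; rewrite sqnormZ rmorphM /= conjC_nat -natrM.
  by rewrite !rmorph_nat.
by move=> E; lra.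
Qed.

(** Moving a near-minimiser along [w] can lower the squared distance by at most
    [e]. *)
Let near_min_orth v (e : R) u w : 0 <= e -> near_min v e u -> subspace_set L w ->
  `|'[v - u, w]| ^+ 2 <= (e * sqnorm w)%:C.
Proof.
move=> e0 [Lu ud] Lw.
have [->|w0] := eqVneq w 0.
  by rewrite hdot0r normr0 expr0n /= lecR mulr_ge0 // sqnorm_ge0.
have ww : '[w, w] != 0 by rewrite hdot_eq0.
(* the step along [w] that brings [u] closest to [v] *)
pose a := '[v - u, w] / '[w, w].
have Lx : subspace_set L (u + a *: w) by apply: subspaceD => //; apply: subspaceZ.
have dx := dist_le v Lx.
have wwc : ('[w, w])^* = '[w, w].
  by rewrite -hdotC.
have E : (sqnorm (v - (u + a *: w)))%:C =
    (sqnorm (v - u))%:C - `|'[v - u, w]| ^+ 2 / (sqnorm w)%:C.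
  rewrite !sqnormE normCK opprD addrA.
  have aC : a^* = '[v - u, w]^* / '[w, w] by rewrite rmorphM fmorphV /= wwc.
  rewrite (hdotBl _ (a *: w)) !(hdotBr _ (a *: w)) !hdotZl !hdotZr (hdotC w (v
    - u)) aC /a.
  by field.
have q : `|'[v - u, w]| ^+ 2 = (complex.Re (`|'[v - u, w]| ^+ 2))%:C.
  by rewrite RRe_real // ger0_real // exprn_ge0.
rewrite q in E *; move: (complex.Re _) E => c {q} E; rewrite lecR.
have sw : 0 < sqnorm w by rewrite lt_def sqnorm_ge0 andbT -(inj_eq (@complexI
  R)) sqnormE.
have {}E : sqnorm (v - (u + a *: w)) = sqnorm (v - u) - c / sqnorm w.
  by apply: complexI; rewrite E rmorphB rmorphM /= fmorphV.
have : c / sqnorm w <= e by lra.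
by rewrite ler_pdivrMr.
Qed.

(** The near-minimisers of the distance from [v] to [L] generate a Cauchy
    filter; its limit is the projection. *)
Lemma projection_exists v : exists2 p, subspace_set L p & forall w,
  subspace_set L w -> '[v - p, w] = 0.
Proof.
pose F := filter_from [set e : R | 0 < e] (near_min v).
have FF : ProperFilter F.
  apply: filter_from_proper => [|e /= e0].
    apply: filter_from_filter; first by exists 1; rewrite /= ltr01.
    move=> e f /= e0 f0; exists (Num.min e f); first by rewrite /= lt_min e0.
    move=> w [Lw ww]; split; split=> //; apply: le_trans ww _.
      by rewrite lerD2l ge_min lexx.
    by rewrite lerD2l ge_min lexx orbT.
  have [_ [w Lw <-] wd] := inf_adherent e0 (dist_inf v).
  by exists w; split=> //; exact: ltW.
have Fc : cauchy F.
  apply/cauchyP => e e0.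
  have er : e = (complex.Re e)%:C by rewrite RRe_real // ger0_real // ltW.
  set r := complex.Re e in er; have r0 : 0 < r by rewrite -ltcR -er.
  pose d := (r / 2) ^+ 2 / 4;
  have d0 : 0 < d by rewrite divr_gt0 ?exprn_gt0 ?divr_gt0.
  have [x xd] : exists x, near_min v d x.
    have [_ [w Lw <-] wd] := inf_adherent d0 (dist_inf v).
    by exists w; split=> //; exact: ltW.
  exists x, d => // w wd; rewrite -ball_normE /=.
  have := near_min_diam xd wd; rewrite /d mulrC divfK ?pnatr_eq0 //.
  rewrite sqnorm_norm_le ?divr_ge0 ?(ltW r0) // => h; apply: le_lt_trans h _.
  by rewrite er ltcR ltr_pdivrMr // ltr_pMr // ltr1n.
have /cvg_ex[p Fp] := @cauchy_cvg V F FF Fc.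
exists p.
  apply: (@closed_cvg _ _ F FF id (L : set V)) Fp; first exact: subspace_closed.
  by exists 1 => [/=|w []].
move=> w Lw.
have c1 : (fun u => '[v - u, w]) @ F --> ('[v - p, w] : C).
  have -> : (fun u => '[v - u, w]) = (fun u => '[v, w] - '[u, w]).
    by apply/funext => u; rewrite hdotBl.
  rewrite hdotBl; apply: (@cvgB _ C); first exact: cvg_cst.
  exact: cvg_trans
    (cvg_app (fun u : V => '[u, w] : C) Fp) (@hdot_continuousl _ _ w p).
have c2 : (fun u => '[v - u, w]) @ F --> (0 : C).
  apply/(@cvgrPdist_le _ C) => e e0.
  have er : e = (complex.Re e)%:C by rewrite RRe_real // ger0_real // ltW.
  set r := complex.Re e in er; have r0 : 0 < r by rewrite -ltcR -er.
  pose d := r ^+ 2 / (sqnorm w + 1).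
  have w1 : 0 < sqnorm w + 1 by rewrite ltr_wpDl ?sqnorm_ge0.
  have d0 : 0 < d by rewrite divr_gt0 ?exprn_gt0.
  exists d => // u ud /=; rewrite sub0r normrN.
  have := near_min_orth (ltW d0) ud Lw => h.
  rewrite -(@ler_pXn2r _ 2) ?nnegrE ?(ltW e0) //.
  apply: le_trans h _;
    rewrite er -(rmorphXn (real_complex R)) lecR /d -[leRHS](@divfK _ (sqnorm w
      + 1)) ?gt_eqF //.
  by rewrite ler_wpM2l ?lerDl // ltW // divr_gt0 ?exprn_gt0.
exact: (cvg_unique (@norm_hausdorff _ C) c1 c2).
Qed.

Lemma sub_hilbertP (x : sub_hilbert L) : subspace_set L (val x).
Proof. by case: x => x /= /asboolP. Qed.

Lemma orth_projP v w : subspace_set L w -> '[v - orth_proj L v, w] = 0.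
Proof.
move=> Lw; have [p Lp pP] := projection_exists v.
have /xgetPex/(_ (SubHilbert (asboolT Lw))) : exists q : sub_hilbert L,
    [set p : sub_hilbert L | forall w : sub_hilbert L, '[v - val p, val w] = 0] q.
  by exists (SubHilbert (asboolT Lp)) => x /=; exact/pP/sub_hilbertP.
exact.
Qed.

Lemma orth_proj_in v : subspace_set L (orth_proj L v).
Proof. exact: sub_hilbertP. Qed.

Lemma orth_proj_unique v p : subspace_set L p -> (forall w, subspace_set L w ->
  '[v - p, w] = 0) ->
  orth_proj L v = p.
Proof.
move=> Lp pP; apply/eqP; rewrite -subr_eq0 -hdot_eq0.
have Ld : subspace_set L (orth_proj L v - p) by apply: subspaceB => //;
  exact: orth_proj_in.
have -> : '[orth_proj L v - p, orth_proj L v - p] =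
  '[v - p, orth_proj L v - p] - '[v - orth_proj L v, orth_proj L v - p].
  by rewrite -hdotBl opprB [in RHS]addrC addrA subrK.
by rewrite pP // orth_projP // subrr.
Qed.

Lemma orth_proj_id v : subspace_set L v -> orth_proj L v = v.
Proof. by move=> Lv; apply: orth_proj_unique => // w _; rewrite subrr hdot0l. Qed.

Lemma orth_proj_linear : linear (orth_proj L).
Proof.
move=> a u v; apply: orth_proj_unique.
  by apply: subspaceP; exact: orth_proj_in.
move=> w Lw; rewrite opprD addrACA -scalerBr hdotDl hdotZl !orth_projP //.
by rewrite mulr0 addr0.
Qed.

Lemma orth_projD u v : orth_proj L (u + v) = orth_proj L u + orth_proj L v.
Proof. by have := orth_proj_linear 1 u v; rewrite !scale1r. Qed.

Lemma orth_projB u v : orth_proj L (u - v) = orth_proj L u - orth_proj L v.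
Proof. by have := orth_proj_linear (-1) v u; rewrite !scaleN1r ![- _ + _]addrC. Qed.

Lemma orth_proj0 : orth_proj L 0 = 0.
Proof. by have := orth_projB 0 0; rewrite !subrr. Qed.

Lemma orth_projZ (a : C) u : orth_proj L (a *: u) = a *: orth_proj L u.
Proof. by have := orth_proj_linear a u 0; rewrite orth_proj0 !addr0. Qed.

Lemma orth_proj_sum (J : Type) (s : seq J) (f : J -> V) :
  orth_proj L (\sum_(j <- s) f j) = \sum_(j <- s) orth_proj L (f j).
Proof. exact: (big_morph _ orth_projD orth_proj0). Qed.

Lemma val_sum (J : Type) (s : seq J) (f : J -> sub_hilbert L) :
  val (\sum_(j <- s) f j) = \sum_(j <- s) val (f j).
Proof. exact: (big_morph (val : sub_hilbert L -> V)). Qed.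

Lemma hdot_orth_projl v w : subspace_set L w -> '[orth_proj L v, w] = '[v, w].
Proof. by move=> /(orth_projP v) /eqP; rewrite hdotBl subr_eq0 eq_sym => /eqP. Qed.

Lemma hdot_orth_projr v w : subspace_set L w -> '[w, orth_proj L v] = '[w, v].
Proof. by move=> Lw; rewrite hdotC hdot_orth_projl // -hdotC. Qed.

Lemma orth_proj_sa u v : '[orth_proj L u, v] = '[u, orth_proj L v].
Proof.
by rewrite -(hdot_orth_projr v (orth_proj_in u)) hdot_orth_projl //;
  exact: orth_proj_in.
Qed.

Lemma orth_proj_sqnorm_le v : sqnorm (orth_proj L v) <= sqnorm v.
Proof.
rewrite -lecR !sqnormE -subr_ge0.
have -> : '[v, v] - '[orth_proj L v, orth_proj L v] =
    '[v - orth_proj L v, v - orth_proj L v].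
  rewrite (hdotBr _ _ (v - _)) (orth_projP v (orth_proj_in v)) subr0.
  by rewrite hdotBl (hdot_orth_projr _ (orth_proj_in v)).
by rewrite hdotxx exprn_ge0.
Qed.

Lemma orth_proj_norm_le v : `|orth_proj L v| <= `|v|.
Proof.
rewrite -(@ler_pXn2r _ 2) ?nnegrE // -!hdotxx -!sqnormE lecR.
exact: orth_proj_sqnorm_le.
Qed.

End Projection.

(** A closed subspace is its own double orthogonal: what [v] loses when
    projected onto the orthogonal of [L] lies in [L]. *)
Lemma orth_proj_orth (R : realType) (V : hilbertType R) (L : closed_subspace V)
  (v : V) : orth_proj (orth L) v = v - orth_proj L v.
Proof.
apply: orth_proj_unique => [w Lw|w Lw]; first exact: orth_projP.
rewrite opprB addrC subrK hdotC Lw ?rmorph0 //.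
exact: orth_proj_in.
Qed.

(** * Orthonormal bases, traces and dimensions *)

Section Trace.
Variables (R : realType) (V : hilbertType R).
Local Notation C := R[i].
Implicit Types u v w : V.

Lemma lin_span_sub (A : set V) u : A u -> lin_span A u.
Proof.
move=> Au; exists 1%N, (fun=> 1), (fun=> u); split=> //.
by rewrite big_ord1 scale1r.
Qed.

Lemma lin_spanD (A : set V) u v : lin_span A u -> lin_span A v ->
  lin_span A (u + v).
Proof. by move=> Au Av; rewrite -[u]scale1r; exact: lin_spanP. Qed.

Lemma lin_spanZ (A : set V) (a : C) u : lin_span A u -> lin_span A (a *: u).
Proof. by move=> Au; rewrite -[_ *: _]addr0; apply: lin_spanP => //;
  exact: lin_span0. Qed.

Lemma lin_span_sum (A : set V) (J : eqType) (s : seq J) (f : J -> V) :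
  (forall j, j \in s -> lin_span A (f j)) -> lin_span A (\sum_(j <- s) f j).
Proof.
move=> Lf; rewrite big_seq; elim/big_ind: _ => //; first exact: lin_span0.
exact: lin_spanD.
Qed.

Lemma lin_span_ind (A P : set V) : P 0 ->
  (forall (a : C) u v, P u -> P v -> P (a *: u + v)) -> A `<=` P ->
  lin_span A `<=` P.
Proof.
move=> P0 PD AP _ [m [a [u [Au ->]]]].
elim/big_ind: _ => // [x y Px Py|i _]; first by rewrite -[x]scale1r; exact: PD.
by rewrite -[_ *: _]addr0; apply: PD => //; exact: AP.
Qed.

Definition orthonormal_set (B : set V) :=
  forall u v, B u -> B v -> '[u, v] = (u == v)%:R.

(** Zorn's lemma gives a maximal orthonormal set; a vector outside its closed
    span would extend it by the normalised residual of its projection. *)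
Lemma orthonormal_basis_exists :
  exists (I : choiceType) (b : I -> V), orthonormal_basis b.
Proof.
have [B [Bon Bmax]] : exists B, orthonormal_set B /\
    forall B', B `<` B' -> ~ orthonormal_set B'.
  apply: Zorn_bigcup => F FP Ftot u v [X FX Xu] [Y FY Yv].
  by have [XY|YX] := Ftot _ _ FX FY; [apply: (FP Y)|apply: (FP X)] => //;
    [exact: XY|exact: YX].
pose I : choiceType := {v : V | `[< B v >]}.
pose b (i : I) : V := val i.
have bB (i : I) : B (b i) by apply/asboolP; exact: (valP i).
exists I, b; split=> [i j|]; first by rewrite Bon // (inj_eq val_inj).
apply/seteqP; split=> // v _; apply: contrapT => vB.
pose L := closed_span (range b).
pose w := v - orth_proj L v.
have w0 : w != 0.
  apply/eqP => /eqP; rewrite subr_eq0 => /eqP vL; apply: vB; rewrite vL.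
  exact: (@orth_proj_in _ _ L).
have wB u : B u -> '[w, u] = 0.
  move=> Bu; apply: orth_projP; apply: subset_closure; apply: lin_span_sub.
  by exists (exist _ u (asboolT Bu)).
pose e := `|w|^-1 *: w.
have eB u : B u -> '[e, u] = 0 by move=> Bu; rewrite hdotZl wB // mulr0.
have ee : '[e, e] = 1.
  rewrite hdotxx normrZ normfV normr_id mulVf ?expr1n //.
  by rewrite normr_eq0.
have eNB : ~ B e.
  by move=> Be; have := eB _ Be; rewrite ee => /eqP; rewrite oner_eq0.
have ne u : B u -> (u == e) = false.
  by move=> Bu; apply/eqP => ue; apply: eNB; rewrite -ue.
apply: (Bmax (B `|` [set e])).
  by split=> [|h]; [exact: subsetUl|apply: eNB; apply: h; right].
move=> x y [Bx|->] [By|->]; first exact: Bon.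
- by rewrite ne // hdotC eB // rmorph0.
- by rewrite eq_sym ne // eB.
- by rewrite eqxx ee.
Qed.

Section Parseval.
Variables (I : choiceType) (b : I -> V).
Hypothesis b_basis : orthonormal_basis b.

Let psum (A : {fset I}) v := \sum_(i <- A) '[v, b i] *: b i.

Let psum_dot (A : {fset I}) v i : i \in A -> '[v - psum A v, b i] = 0.
Proof.
move=> iA; rewrite hdotBl hdot_suml (big_fsetD1 i) //= hdotZl.
rewrite (proj1 b_basis) eqxx mulr1 big_seq big1 ?addr0 ?subrr // => j.
by rewrite !inE hdotZl (proj1 b_basis) => /andP[/negPf-> _]; rewrite mulr0.
Qed.

(** The partial sum over [A] is the projection of [v] onto the span of the basis
    vectors indexed by [A], hence its best approximation there. *)
Let psum_best (A : {fset I}) v w (J : eqType) (s : seq J) (a : J -> C)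
  (f : J -> I) :
  (forall j, j \in s -> f j \in A) -> w = \sum_(j <- s) a j *: b (f j) ->
  `|v - psum A v| <= `|v - w|.
Proof.
move=> fA wE; have [->|z0] := eqVneq (v - psum A v) 0; first by rewrite normr0.
have zb i : i \in A -> '[b i, v - psum A v] = 0.
  by move=> iA; rewrite hdotC psum_dot // rmorph0.
have zw : '[v - psum A v, psum A v - w] = 0.
  rewrite hdotC hdotBl wE !hdot_suml !big_seq.
  rewrite !big1 ?subr0 ?rmorph0 // => i iA;
  by rewrite hdotZl zb ?mulr0 //; exact: fA.
have E : '[v - psum A v, v - w] = `|v - psum A v| ^+ 2.
  by rewrite -hdotxx -[v - w](subrKA (psum A v)) (hdotDr (v - psum A v) (psum A
    v - w)) zw addr0.
have := hdot_norm_le (v - psum A v) (v - w).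
rewrite E normrX normr_id expr2 ler_pM2l // normr_gt0 //.
Qed.

(** Some finite combination of basis vectors is close to [v], and the partial
    sums over all larger index sets are at least as close. *)
Lemma parseval v u :
  (fun A : {fset I} => \sum_(i <- A) '[v, b i] * '[b i, u])
    @ @summability.totally I --> ('[v, u] : C).
Proof.
apply/(@cvgrPdist_le _ C) => e e0.
pose d := e / (`|u| + 1); have u1 : 0 < `|u| + 1 by rewrite ltr_wpDl.
have d0 : 0 < d by rewrite divr_gt0.
have : closure (lin_span (range b)) v by rewrite (proj2 b_basis).
move=> /(_ _ (nbhsx_ballx v _ d0))[w [[m [a [x [xb wE]]]]]].
rewrite -ball_normE /= => vw.
have /choice[f fE] : forall j, exists i, b i = x j.
  by move=> j; have [i _ <-] := xb j; exists i.
exists [fset f j | j : 'I_m]%fset => // A /= fA.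
rewrite [X in '[_, _] - X](_ : _ = '[psum A v, u]); last first.
  by rewrite hdot_suml; apply: eq_bigr => i _; rewrite hdotZl.
rewrite -hdotBl; apply: le_trans (hdot_norm_le _ _) _.
have vd : `|v - psum A v| <= d.
  apply: le_trans (ltW vw).
  apply: (@psum_best A v w _ (index_enum 'I_m) a f) => [j _|].
    by apply: (fsubsetP fA); apply/imfsetP; exists j.
  by rewrite wE; apply: eq_bigr => j _; rewrite fE.
rewrite -[leRHS](@divfK _ (`|u| + 1)) ?gt_eqF //.
by apply: ler_pM => //; rewrite lerDl.
Qed.

End Parseval.

(** Parseval's identity in the given basis, applied to each rank-one term. *)
Lemma has_trace_finite_rank (A : V -> V) (J : Type) (s : seq J) (x y : J -> V) :
  (forall v, A v = \sum_(j <- s) '[v, x j] *: y j) ->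
  has_trace A (\sum_(j <- s) '[y j, x j]).
Proof.
move=> AE I b bb.
have -> : summability.partial_sum (fun i => '[A (b i), b i]) =
    (fun F : {fset I} => \sum_(j <- s) \sum_(i <- F) '[y j, b i] * '[b i, x j]).
  apply/funext => F; rewrite partial_sumE exchange_big /=.
  apply: eq_bigr => i _; rewrite AE hdot_suml; apply: eq_bigr => j _.
  by rewrite hdotZl mulrC.
elim: s {AE} => [|j s IHs].
  rewrite big_nil; under eq_fun do rewrite big_nil; exact: cvg_cst.
rewrite big_cons; under eq_fun do rewrite big_cons.
by apply: (@cvgD _ C); [exact: parseval|exact: IHs].
Qed.

(** The existence of an orthonormal basis makes the trace unique. *)
Lemma op_trace_eq (A : V -> V) (t : C) : has_trace A t -> op_trace A = t.
Proof.
move=> At; have [I [b bb]] := orthonormal_basis_exists.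
have : has_trace A (op_trace A) by apply: (@xgetPex _ 0); exists t.
move=> /(_ I b bb) h; exact: (cvg_unique (@norm_hausdorff _ C) h (At I b bb)).
Qed.

Definition orthonormal_seq (s : seq V) :=
  uniq s /\ orthonormal_set [set` s].

(** Gram-Schmidt for a possibly dependent list: a vector with vanishing residual
    contributes nothing. *)
Lemma orthonormalize (s : seq V) : exists us : seq V,
  [/\ orthonormal_seq us, forall u, u \in us -> lin_span [set` s] u &
      forall v, v \in s -> v = \sum_(u <- us) '[v, u] *: u].
Proof.
elim: s => [|x s [us [[usU usO] usS usE]]].
  by exists [::]; split=> //; split=> // u v.
have sub : lin_span [set` s] `<=` lin_span [set` x :: s].
  apply: lin_span_ind; first exact: lin_span0.
    by move=> *; exact: lin_spanP.
  by move=> v vs; apply: lin_span_sub; rewrite /= inE (vs : v \in s) orbT.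
pose r := x - \sum_(u <- us) '[x, u] *: u.
have ru u : u \in us -> '[r, u] = 0.
  move=> uu; rewrite hdotBl hdot_suml (bigD1_seq u) //= hdotZl (usO u u)
    // eqxx mulr1.
  rewrite big_seq_cond big1 ?addr0 ?subrr // => v /andP[vu /negPf uv].
  by rewrite hdotZl (usO v u) // uv mulr0.
have [r0|r0] := eqVneq r 0.
  exists us; split=> // [u /usS /sub //|v].
  rewrite inE => /predU1P[->|/usE //].
  by apply/eqP; rewrite -subr_eq0; apply/eqP.
pose e := `|r|^-1 *: r.
have nr0 : `|r| != 0 by rewrite normr_eq0.
have eu u : u \in us -> '[e, u] = 0 by move=> uu; rewrite hdotZl ru // mulr0.
have ue u : u \in us -> '[u, e] = 0 by move=> uu; rewrite hdotC eu // rmorph0.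
have ee : '[e, e] = 1 by rewrite hdotxx normrZ normfV normr_id mulVf ?expr1n.
have eN : e \notin us.
  by apply/negP => /eu; rewrite ee => /eqP; rewrite oner_eq0.
have ne u : u \in us -> (u == e) = false.
  by move=> uu; apply: contraNF eN => /eqP <-.
have xe : '[x, e] *: e = r.
  have -> : '[x, e] = '[r, e].
    rewrite /r hdotBl hdot_suml big_seq big1 ?subr0 // => u uu.
    by rewrite hdotZl ue // mulr0.
  have re : `|r| *: e = r by rewrite scalerA mulfV ?scale1r.
  have -> : '[r, e] = '[`|r| *: e, e] by rewrite re.
  by rewrite hdotZl ee mulr1.
exists (e :: us); split.
- split; first by rewrite /= eN.
  move=> u v /=; rewrite !inE => /predU1P[->|uu] /predU1P[->|vu].
  + by rewrite eqxx ee.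
  + by rewrite eu // eq_sym ne.
  + by rewrite ue // ne.
  + exact: usO.
- move=> u; rewrite inE => /predU1P[->|/usS /sub //].
  apply: lin_spanZ; rewrite /r -scaleN1r; apply: lin_spanD.
    by apply: lin_span_sub; rewrite /= inE eqxx.
  by apply: lin_spanZ; apply: lin_span_sum => u' /usS /sub; exact: lin_spanZ.
- move=> v; rewrite inE => /predU1P[->|vs]; rewrite big_cons.
    by rewrite xe addrC /r addrC subrK.
  rewrite {1}(usE v vs) (_ : '[v, e] = 0) ?scale0r ?add0r //.
  rewrite (usE v vs) hdot_suml big_seq big1 // => u uu.
  by rewrite hdotZl ue // mulr0.
Qed.

Lemma lin_span_rangeP (d : nat) (b : 'I_d -> V) v :
  lin_span (range b) v -> exists a : 'I_d -> C, v = \sum_(i < d) a i *: b i.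
Proof.
apply: (lin_span_ind (P := [set v | exists a : 'I_d -> C, v =
  \sum_(i < d) a i *: b i])).
- by exists (fun=> 0); rewrite big1 // => i _; rewrite scale0r.
- move=> a _ _ [f ->] [g ->]; exists (fun i => a * f i + g i).
  rewrite scaler_sumr -big_split /=; apply: eq_bigr => i _.
  by rewrite scalerDl scalerA.
- move=> _ [i _ <-]; exists (fun j => (j == i)%:R).
  rewrite (bigD1 i) //= eqxx scale1r big1 ?addr0 // => j /negPf->.
  by rewrite scale0r.
Qed.

Lemma has_dim_leq (L : set V) d d' : has_dim L d -> has_dim L d' -> (d <= d')%N.
Proof.
move=> [b [bL bfree _]] [c [_ _ Lc]].
have /choice[f fE] i : exists a : 'I_d' -> C, b i = \sum_(j < d') a j *: c j.
  by apply: lin_span_rangeP; apply: Lc.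
pose A := \matrix_(i < d, j < d') f i j.
rewrite leqNgt; apply/negP => dd.
have : kermx A != 0.
  rewrite kermx_eq0 /row_free; apply: contraTN dd => /eqP <-.
  by rewrite -leqNgt rank_leq_col.
(* with too few columns the coordinate matrix has a row relation [r] *)
move=> /rowV0Pn[r /sub_kermxP rA /eqP]; apply; apply/rowP => i; rewrite mxE.
apply: (bfree (fun i => r 0 i)).
under eq_bigr do rewrite fE scaler_sumr.
rewrite exchange_big big1 //= => j _.
under eq_bigr do rewrite scalerA.
rewrite -scaler_suml; move/matrixP: rA => /(_ 0 j); rewrite !mxE => rA.
rewrite (_ : \sum_i _ = 0) ?scale0r // -[RHS]rA.
by apply: eq_bigr => l _; rewrite mxE.
Qed.

Lemma dim_eq (L : set V) d : has_dim L d -> Defs.dim L = d.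
Proof.
move=> Ld; have h : has_dim L (Defs.dim L) by apply: (@xgetPex _ 0%N); exists d.
by apply/eqP; rewrite eqn_leq !(has_dim_leq h, has_dim_leq Ld).
Qed.

Lemma has_dim_orthonormal (L : set V) (us : seq V) : orthonormal_seq us ->
  (forall u, u \in us -> L u) ->
  (forall v, L v -> v = \sum_(u <- us) '[v, u] *: u) -> has_dim L (size us).
Proof.
move=> [usU usO] uL LE; exists (fun i => nth 0 us i); split.
- by move=> i; apply/uL/mem_nth.
- move=> a a0 j; have /(congr1 (fun v => '[v, nth 0 us j])) := a0.
  rewrite hdot0l hdot_suml (bigD1 j) //= hdotZl (usO (nth 0 us j)) ?mem_nth
    //= ?mem_nth // eqxx mulr1.
  rewrite big1 ?addr0 // => i /negPf ij.
  by rewrite hdotZl (usO (nth 0 us i)) /= ?mem_nth // nth_uniq //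
    (ij : (i == j :> nat) = false) mulr0.
- move=> v /LE ->; rewrite (big_nth 0) big_mkord.
  by apply: lin_span_sum => i _; apply: lin_spanZ; apply: lin_span_sub; exists i.
Qed.

End Trace.

(** The range of an orthogonal projection [A] of finite rank lying in [L] is the
    same whether measured in [L] or in the ambient space, and its dimension is
    the trace of [A], as an orthonormal basis of that range shows. *)
Lemma projection_rank_trace (R : realType) (V : hilbertType R)
    (L : closed_subspace V) (A : V -> V) (J : eqType) (s : seq J)
    (x : J -> V) (y : J -> sub_hilbert L) :
  linear A -> (forall v w, '[A v, w] = '[v, A w]) ->
  (forall v, A v = \sum_(j <- s) '[v, x j] *: val (y j)) ->
  (forall j, j \in s -> A (val (y j)) = val (y j)) ->
  exists d, [/\ op_rank A = d, Defs.dim (lin_span [set` map y s]) = d &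
    has_trace A d%:R].
Proof.
move=> Al A_sa AE Ay; set Y := [set` map y s].
have A_span v : exists2 w, lin_span Y w & A v = val w.
  exists (\sum_(j <- s) '[v, x j] *: y j); last by rewrite val_sum AE.
  by apply: lin_span_sum => j js; apply/lin_spanZ/lin_span_sub/map_f.
have [us [us_on us_span usE]] := orthonormalize (map y s).
have spanE w : lin_span Y w -> w = \sum_(u <- us) '[w, u] *: u.
  move: w; apply: (lin_span_ind (P := [set v | v = \sum_(u <- us) '[v, u] *: u])).
  - by rewrite /= big1 // => u _; rewrite hdot0l scale0r.
  - move=> z u w uE wE /=; rewrite {1}uE {1}wE scaler_sumr -big_split.
    by apply: eq_bigr => v _; rewrite hdotDl hdotZl scalerDl scalerA.
  - by move=> w; exact: usE.
have A_fix w : lin_span Y w -> A (val w) = val w.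
  move: w; apply: (@lin_span_ind _ (sub_hilbert L) Y [set w | A (val w) = val w]).
  - by have := Al (-1) 0 0; rewrite !scaleN1r oppr0 addr0 addNr.
  - move=> z u w uE wE; change (A (z *: val u + val w) = z *: val u + val w).
    by rewrite Al; congr (_ *: _ + _).
  - by move=> _ /mapP[j js ->]; exact: Ay.
have A_basis v : A v = \sum_(u <- us) '[v, val u] *: val u.
  have [w w_span wE] := A_span v; rewrite wE {1}(spanE w w_span) val_sum.
  rewrite [LHS]big_seq [RHS]big_seq; apply: eq_bigr => u /us_span u_span.
  change ('[val w, val u] *: val u = '[v, val u] *: val u).
  by rewrite -wE A_sa A_fix.
exists (size us); split.
- rewrite /op_rank -(size_map val us); apply: dim_eq; apply: has_dim_orthonormal.
  + split; first by rewrite map_inj_uniq ?(proj1 us_on) //; exact: val_inj.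
    move=> _ _ /mapP[u uu ->] /mapP[v vu ->]; rewrite (inj_eq val_inj).
    exact: (proj2 us_on).
  + by move=> _ /mapP[u /us_span u_span ->]; exists (val u) => //; exact: A_fix.
  + move=> _ [v _ <-]; rewrite big_map {1}A_basis [LHS]big_seq [RHS]big_seq.
    by apply: eq_bigr => u /us_span u_span; rewrite A_sa A_fix.
- by apply: dim_eq; apply: has_dim_orthonormal => // u /us_span.
- have -> : (size us)%:R = \sum_(u <- us) '[val u, val u].
    rewrite -sum1_size natr_sum [LHS]big_seq [RHS]big_seq.
    by apply: eq_bigr => u uu; rewrite [RHS](proj2 us_on u u uu uu) eqxx.
  exact: has_trace_finite_rank.
Qed.

(** * Adjoints and positive square roots *)

Section AdjointSqrt.
Variable R : realType.
Implicit Types V W : hilbertType R.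

Lemma adjoint_eq V W (A : V -> W) (B : W -> V) :
  (forall x y, '[A x, y] = '[x, B y]) -> adjoint A = B.
Proof.
move=> AB; have : [set B : W -> V | forall x y, '[A x, y] = '[x, B y]] (adjoint A).
  by apply: (@xgetPex _ (fun=> 0)); exists B.
move=> h; apply/funext => y; apply: hdot_inj => x.
by rewrite hdotC -h AB -hdotC.
Qed.

Lemma bounded_linear_norm_le V W (A : V -> W) :
  linear A -> (forall x, `|A x| <= `|x|) -> bounded_linear A.
Proof.
move=> Al An; split=> // x; apply/(@cvgrPdist_le _ W) => e e0.
apply: filterS (nbhsx_ballx x _ e0) => y; rewrite -ball_normE /= => /ltW xy.
apply: le_trans xy; apply: le_trans (An _).
have -> : A (x - y) = A x - A y; last by [].
by rewrite -scaleN1r addrC Al scaleN1r addrC.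
Qed.

(** Polarisation: that [<B (a x + y), a x + y>] is real for [a = 1] and for
    [a = i] determines the cross terms. *)
Lemma positive_op_sa V (B : V -> V) : linear B -> positive_op B ->
  forall x y, '[B x, y] = '[x, B y].
Proof.
move=> Bl Bp x y.
have BZD (a : R[i]) u v : B (a *: u + v) = a *: B u + B v by exact: Bl.
have real (z : V) : '[B z, z]^* = '[B z, z].
  by apply/CrealP; apply: ger0_real; exact: Bp.
have cross (a : R[i]) :
    a * '[B x, y] + a^* * '[B y, x] = a^* * '[y, B x] + a * '[x, B y].
  have := real (a *: x + y); rewrite BZD -hdotC.
  rewrite !hdotDl !hdotDr !hdotZl !hdotZr.
  have := real x; have := real y; rewrite -!hdotC => -> -> E.
  apply: (addrI (a * (a^* * '[B x, x]))); apply: (addIr '[B y, y]).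
  by move: E; rewrite !addrA => E; rewrite -[LHS]E; ring.
have := cross 'i; have := cross 1.
rewrite conjC1 conjCi !mul1r !mulNr => c1 c2.
have c3 : '[B x, y] - '[B y, x] = '[x, B y] - '[y, B x].
  by apply: (mulfI (@neq0Ci R[i])); rewrite !mulrBr c2 addrC.
apply: (@mulIf _ 2); first by rewrite pnatr_eq0.
rewrite !mulr_natr !mulr2n -{1}(subrK '[B y, x] '[B x, y]) -addrA [_ + '[B x,
  y]]addrC.
by rewrite c1 c3; ring.
Qed.

(** On the range of an orthogonal projection [A], a positive root [B] satisfies
    [(B + 1)(B - 1) = 0] with [B + 1] injective; on the kernel of [A] it
    vanishes since [|B x|^2 = <A x, x>]. *)
Lemma sqrt_op_idempotent V (A : V -> V) : bounded_linear A -> positive_op A ->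
  A \o A = A -> sqrt_op A = A.
Proof.
move=> Ab Ap AA; have : [set B : V -> V | [/\ bounded_linear B, positive_op B &
    B \o B = A]] (sqrt_op A).
  by apply: (@xgetPex _ (fun=> 0)); exists A.
move: (sqrt_op A) => B [[Bl _] Bp BB]; apply/funext => x.
have BBE y : B (B y) = A y by rewrite -BB.
have AAE y : A (A y) = A y by rewrite -[in RHS]AA.
have BD y z : B (y - z) = B y - B z by rewrite -scaleN1r addrC Bl scaleN1r addrC.
have AD y z : A (y - z) = A y - A z by rewrite -scaleN1r addrC (proj1 Ab)
  scaleN1r addrC.
have ker y : A y = 0 -> B y = 0.
  move=> Ay; apply/eqP; rewrite -hdot_eq0 -(positive_op_sa Bl Bp) BBE Ay.
  by rewrite hdot0l.
have ran y : A y = y -> B y = y.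
  move=> Ay; apply/eqP; rewrite -subr_eq0 -hdot_eq0; apply/eqP.
  set z := B y - y; have Bz : B z = - z by rewrite /z BD BBE Ay opprB.
  have := Bp z; rewrite Bz -scaleN1r hdotZl mulN1r oppr_ge0 => zz.
  by apply/eqP; rewrite eq_le zz hdotxx exprn_ge0.
have := ker (x - A x); rewrite AD AAE subrr => /(_ erefl).
by rewrite BD (ran (A x)) // => /eqP; rewrite subr_eq0 => /eqP.
Qed.

End AdjointSqrt.

(** * Limits of antitone functions of several indices *)

Section RealToComplexLimits.
Variable R : realType.

Lemma cvg_above (g : nat -> R) (l : R) : (forall m, l <= g m) ->
  (forall e, 0 < e -> exists m0, forall m, (m0 <= m)%N -> g m < l + e) ->
  (fun m => (g m)%:C : R[i]) @ \oo --> (l%:C : R[i]).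
Proof.
move=> lg gl; apply/(@cvgrPdist_lt _ R[i]) => e e0.
have er : e = (complex.Re e)%:C by rewrite RRe_real // ger0_real // ltW.
have r0 : 0 < complex.Re e by rewrite -ltcR -er.
have [m0 m0P] := gl _ r0; exists m0 => // m /= /m0P gm.
rewrite distrC -rmorphB er ger0_norm ?ltcR ?lecR ?subr_ge0 //.
by rewrite ltrBlDl.
Qed.

End RealToComplexLimits.

Section Antitone.
Variable R : realType.

Section Glb.
Variable k : nat.
Implicit Types (u : ('I_k -> nat) -> R) (p q : 'I_k -> nat) (l : R).

Definition antitone u :=
  forall p q, (forall i, p i <= q i)%N -> u q <= u p.

Definition is_glb u l :=
  (forall q, l <= u q) /\ forall e, 0 < e -> exists q, u q < l + e.

Lemma glb_exists u l : (forall q, l <= u q) -> exists2 g, is_glb u g & l <= g.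
Proof.
move=> lu; have uinf : has_inf (range u).
  split; first by exists (u (fun=> 0%N)), (fun=> 0%N).
  by exists l => _ [q _ <-].
exists (inf (range u)).
  split=> [q|e e0]; first by apply: ge_inf; [case: uinf|exists q].
  by have [_ [q _ <-] ?] := inf_adherent e0 uinf; exists q.
by apply: lb_le_inf; [case: uinf|move=> _ [q _ <-]].
Qed.

Lemma antitone_cofinal_cvg u l (q : nat -> 'I_k -> nat) :
  antitone u -> is_glb u l -> (forall m i, q m i <= q m.+1 i)%N ->
  (forall p, exists m, forall i, (p i <= q m i)%N) ->
  (fun m => (u (q m))%:C : R[i]) @ \oo --> (l%:C : R[i]).
Proof.
move=> u_anti [lu ul] q_incr q_cof; apply: cvg_above => // e /ul[p up].
have [m0 pm0] := q_cof p; exists m0 => m m0m; apply: le_lt_trans up.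
apply: u_anti => i; apply: leq_trans (pm0 i) _.
by rewrite -(subnK m0m); elim: (m - m0)%N => //= d /leq_trans; apply; rewrite addSn.
Qed.

End Glb.

(** The inner limits of an antitone function are infima, and an infimum can be
    taken one coordinate at a time. *)
Lemma antitone_iter_lim k (u : ('I_k -> nat) -> R) l :
  antitone u -> is_glb u l -> iter_lim (fun q => (u q)%:C) l%:C.
Proof.
elim: k u l => [|k IHk] u l u_anti [lu ul] /=.
  move=> q; congr (_%:C); apply/eqP; rewrite eq_le lu andbT.
  apply/ler_addgt0Pr => e /ul[p]; rewrite (_ : p = q) => [/ltW //|].
  by apply/funext => -[].
pose ext q0 (q : 'I_k -> nat) (i : 'I_k.+1) := oapp q q0 (unlift ord0 i).
have /choice[g gP] q0 : exists g, is_glb (fun q => u (ext q0 q)) g /\ l <= g.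
  have [g glb lg] := glb_exists (fun q => lu (ext q0 q)).
  by exists g.
have ext_le p0 p q0 q : (p0 <= q0)%N -> (forall i, p i <= q i)%N ->
    forall i, (ext p0 p i <= ext q0 q i)%N.
  by move=> pq0 pq i; rewrite /ext; case: (unlift ord0 i) => /=.
exists (fun m => (g m)%:C); split=> [q0|].
  by apply: IHk; [move=> p q pq; apply/u_anti/ext_le|case: (gP q0)].
apply: cvg_above => [m|e e0]; first by case: (gP m).
have [q qe] := ul e e0; exists (q ord0) => m qm.
apply: le_lt_trans qe; have [[gu _] _] := gP m.
apply: le_trans (gu (fun i => q (lift ord0 i))) _; apply: u_anti => i.
rewrite /ext; case: (unliftP ord0 i) => [j|] -> //=.
Qed.

End Antitone.

(** * Weighted averages along coordinates *)

Section WeightedAverages.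
Variable R : realType.

Section Sequences.
Variable w : nat -> R.
Hypothesis w_ge1 : forall j, 1 <= w j.

Let w_ge0 j : 0 <= w j. Proof. exact: le_trans ler01 (w_ge1 j). Qed.

Lemma weight_ge m : m%:R <= \sum_(j < m) w j.
Proof.
rewrite -[m in m%:R]card_ord -sum1_card natr_sum.
by apply: ler_sum => j _; exact: w_ge1.
Qed.

Lemma weight_gt0 m : 0 < \sum_(j < m.+1) w j.
Proof. by apply: lt_le_trans (weight_ge m.+1); rewrite ltr0Sn. Qed.

(** Each new term is at most all the earlier ones, hence at most their average. *)
Lemma weighted_average_noninc (a : nat -> R) m d :
  (forall i j, (i <= j)%N -> a j <= a i) ->
  (\sum_(j < (m + d).+1) w j * a j) / (\sum_(j < (m + d).+1) w j) <=
  (\sum_(j < m.+1) w j * a j) / (\sum_(j < m.+1) w j).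
Proof.
move=> a_anti; elim: d => [|d]; first by rewrite addn0.
apply: le_trans; rewrite addnS; move: (m + d)%N => {}m.
rewrite ler_pdivlMr ?weight_gt0 // mulrAC ler_pdivrMr ?weight_gt0 //.
rewrite big_ord_recr [X in _ <= _ * X]big_ord_recr /= mulrDl mulrDr lerD2l.
rewrite -mulrA [leRHS]mulrC ler_wpM2l // mulrC mulr_suml.
by apply: ler_sum => j _; rewrite ler_wpM2l // a_anti // ltnW.
Qed.

(** Only the first [N] terms can exceed [c], by a bounded total amount, whereas
    the total weight grows without bound. *)
Lemma weighted_average_near (a : nat -> R) (c e : R) N : 0 < e ->
  (forall j, (N <= j)%N -> a j <= c) ->
  exists m, (\sum_(j < m.+1) w j * a j) / (\sum_(j < m.+1) w j) < c + e.
Proof.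
move=> e0 ac; pose K : R := \sum_(j < N) w j * `|a j - c|.
have excess m : \sum_(j < m) w j * (a j - c) <= K.
  have [mN|Nm] := leqP m N.
    rewrite /K (big_ord_widen N (fun j => w j * (a j - c)) mN) big_mkcond /=.
    apply: ler_sum => j _; case: ifP => _; last by rewrite mulr_ge0.
    by rewrite ler_wpM2l // ler_norm.
  rewrite -(subnKC (ltnW Nm)) big_split_ord /= -[leRHS]addr0; apply: lerD.
    by apply: ler_sum => j _; rewrite ler_wpM2l // ler_norm.
  apply: sumr_le0 => j _; rewrite mulr_ge0_le0 // subr_le0 ac //.
  exact: leq_addr.
pose m := Num.bound (K / e); exists m.
rewrite ltr_pdivrMr ?weight_gt0 // mulrDl -ltrBlDl.
rewrite (_ : _ - _ = \sum_(j < m.+1) w j * (a j - c)); last first.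
  rewrite mulr_sumr -sumrB; apply: eq_bigr => j _.
  by rewrite mulrBr (mulrC c).
apply: le_lt_trans (excess _) _.
have K0 : 0 <= K by apply: sumr_ge0 => j _; rewrite mulr_ge0.
have : K / e < m%:R by apply: archi_boundP; rewrite divr_ge0 // ltW.
rewrite ltr_pdivrMr // mulrC => /lt_le_trans; apply.
rewrite ler_wpM2l ?(ltW e0) //; apply: le_trans (weight_ge m.+1).
by rewrite ler_nat.
Qed.

End Sequences.

Variables (k : nat) (w : 'I_k -> nat -> R).
Hypothesis w_ge1 : forall i j, 1 <= w i j.
Implicit Types (u : ('I_k -> nat) -> R) (p q : 'I_k -> nat).

Definition upd (q : 'I_k -> nat) (i : 'I_k) (c : nat) : 'I_k -> nat :=
  fun s => if s == i then c else q s.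

Lemma updE q i c : upd q i c i = c. Proof. by rewrite /upd eqxx. Qed.

Lemma upd_le p q i c d : (forall s, p s <= q s)%N -> (c <= d)%N ->
  forall s, (upd p i c s <= upd q i d s)%N.
Proof. by move=> pq cd s; rewrite /upd; case: eqP. Qed.

Lemma upd_upd q i c d : upd (upd q i c) i d = upd q i d.
Proof. by apply/funext => s; rewrite /upd; case: eqP. Qed.

Lemma upd_id q i : upd q i (q i) = q.
Proof. by apply/funext => s; rewrite /upd; case: eqP => [->|]. Qed.

Definition average (i : 'I_k) u : ('I_k -> nat) -> R := fun q =>
  (\sum_(j < (q i).+1) w i j * u (upd q i j)) / (\sum_(j < (q i).+1) w i j).

Lemma average_antitone i u : antitone u -> antitone (average i u).
Proof.
move=> u_anti p q pq; have w0 j : 0 <= w i j by exact: le_trans ler01 (w_ge1 i j).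
apply: (@le_trans _ _ (average i u (upd q i (p i)))).
  have := @weighted_average_noninc (w i) (w_ge1 i) (fun j => u (upd q i j))
    (p i) (q i - p i)%N.
  rewrite subnKC // => h; rewrite /average updE.
  rewrite [X in _ <= X / _](eq_bigr (fun j : 'I__ => w i j * u (upd q i j))).
    by apply: h => c d cd; apply/u_anti/upd_le.
  by move=> j _; rewrite upd_upd.
rewrite /average updE ler_pM2r ?invr_gt0 ?(weight_gt0 (w_ge1 i)) //.
by apply: ler_sum => j _; rewrite upd_upd ler_wpM2l //; apply/u_anti/upd_le.
Qed.

Lemma average_glb i u l : antitone u -> is_glb u l -> is_glb (average i u) l.
Proof.
move=> u_anti [lu ul]; split=> [q|e e0].
  rewrite /average ler_pdivlMr ?(weight_gt0 (w_ge1 i)) //.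
  rewrite mulr_sumr; apply: ler_sum => j _; rewrite mulrC ler_wpM2l //.
  exact: le_trans ler01 (w_ge1 i j).
have e2 : 0 < e / 2 by rewrite divr_gt0.
have [q qe] := ul _ e2.
have [j qj|m mP] := @weighted_average_near (w i) (w_ge1 i)
  (fun j => u (upd q i j)) (u q) (e / 2) (q i) e2.
  by rewrite -[in leRHS](upd_id q i); apply/u_anti/upd_le.
exists (upd q i m); rewrite /average updE.
under eq_bigr do rewrite upd_upd.
by apply: lt_trans mP _; rewrite [e in ltRHS]splitr addrA ltrD2r.
Qed.

Lemma averages_antitone s u : antitone u -> antitone (foldr average u s).
Proof. by elim: s => //= i s IHs /IHs; exact: average_antitone. Qed.

Lemma averages_glb s u l :
  antitone u -> is_glb u l -> is_glb (foldr average u s) l.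
Proof.
move=> u_anti ul; elim: s => //= i s IHs.
by apply: average_glb => //; exact: averages_antitone.
Qed.

End WeightedAverages.

(** * Averages over simplices *)

Section SimplexAverages.
Variable R : realType.

Definition simplex k m := [set q : {ffun 'I_k -> 'I_m.+1}
  | (\sum_i q i <= m)%N]%SET.

Lemma card_simplex k m : #|simplex k m| = 'C(m + k, k).
Proof.
rewrite addnC -card_partial_ord_partitions.
pose f (t : k.-tuple 'I_m.+1) : {ffun 'I_k -> 'I_m.+1} := [ffun i => tnth t i].
have f_inj : injective f.
  by move=> s t /ffunP st; apply: eq_from_tnth => i; have := st i; rewrite !ffunE.
rewrite -(card_imset _ f_inj); apply: eq_card => q; rewrite inE.
apply/idP/imsetP => [qm|[t]].
  exists [tuple q i | i < k].
    rewrite inE big_tuple (eq_bigr (fun i => nat_of_ord (q i))) // => i _.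
    by rewrite tnth_mktuple.
  by apply/ffunP => i; rewrite ffunE tnth_mktuple.
rewrite inE big_tuple => tm ->;
  rewrite (eq_bigr (fun i => nat_of_ord (tnth t i))) //.
by move=> i _; rewrite ffunE.
Qed.

(** Pascal's rule [d] times, each increment being at most the last one. *)
Lemma bin_shift_le k d r :
  ('C(d + r + k.+1, k.+1) <= 'C(r + k.+1, k.+1) + d * 'C(d + r + k, k))%N.
Proof.
elim: d => [|d IHd]; first by rewrite mul0n addn0.
rewrite !addSn binS [X in (_ + 'C(X, k) <= _)%N]addnS mulSn addnCA addnC leq_add2l.
apply: leq_trans IHd _; rewrite leq_add2l leq_mul2l leq_bin2l ?orbT //.
Qed.

(** Restricting to the tuples with all entries at least [N] costs a proportion
    [O(1/m)] of the simplex, since those tuples contain a translate of the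
    simplex of size [m - k N]. *)
Lemma simplex_average_le k m N (u : ('I_k -> nat) -> R) : (0 < k)%N ->
  (k * N <= m)%N ->
  antitone u -> (forall q, 0 <= u q <= 1) ->
  ('C(m + k, k)%:R)^-1 * (\sum_(q in simplex k m) u (fun i => q i)) <=
    u (fun=> N) + (k * N * k)%:R / (m + k)%:R.
Proof.
case: k u => // k u _ kNm u_anti u01.
have [r mE] : exists r, m = (r + k.+1 * N)%N by exists (m - k.+1 * N)%N;
  rewrite subnK.
pose good := [set q in simplex k.+1 m | [forall i, (N <= q i)%N]]%SET.
pose shift (q : {ffun 'I_k.+1 -> 'I_r.+1}) : {ffun 'I_k.+1 -> 'I_m.+1} :=
  [ffun i => inord (q i + N)].
have shiftE q i : q \in simplex k.+1 r -> (shift q i = q i + N :> nat)%N.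
  rewrite inE => qm; rewrite ffunE inordK // ltnS mE leq_add //.
    by apply: leq_trans qm; rewrite (bigD1 i) //= leq_addr.
  by rewrite mulSn leq_addr.
have good_card : ('C(r + k.+1, k.+1) <= #|good|)%N.
  rewrite -card_simplex -(card_in_imset (f := shift)); last first.
    move=> p q ps qs /ffunP pq; apply/ffunP => i; apply/val_inj/eqP => /=.
    by rewrite -(eqn_add2r N) -!shiftE // pq.
  apply/subset_leq_card/fintype.subsetP => _ /imsetP[q qs ->].
  rewrite !inE; apply/andP; split; last first.
    by apply/forallP => i; rewrite shiftE // leq_addl.
  under eq_bigr do rewrite shiftE //.
  rewrite big_split /= sum_nat_const card_ord [leqRHS]mE leq_add2r.
  by move: qs; rewrite inE.
have good_sub : good \subset simplex k.+1 m.
  by apply/fintype.subsetP => q; rewrite inE => /andP[].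
have := cardsID good (simplex k.+1 m);
  rewrite card_simplex (finset.setIidPr good_sub) => cardE.
set bad := (simplex k.+1 m :\: good)%SET in cardE.
set c := u (fun=> N).
have sum_le : \sum_(q in simplex k.+1 m) u (fun i => q i) <=
    c * 'C(m + k.+1, k.+1)%:R + #|bad|%:R.
  rewrite (big_setID good) /= (finset.setIidPr good_sub) -/bad -cardE natrD
    mulrDr -addrA.
  apply: lerD.
    rewrite mulr_natr -sumr_const; apply: ler_sum => q;
      rewrite !inE => /andP[_ /forallP Nq].
    exact: u_anti.
  apply: le_trans (_ : #|bad|%:R <= _); last first.
    by rewrite lerDr mulr_ge0 //; case/andP: (u01 (fun=> N)).
  rewrite -sumr_const; apply: ler_sum => q _.
  by case/andP: (u01 (fun i => q i)).
have bad_le : (#|bad| <= k.+1 * N * 'C(m + k, k))%N.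
  have := bin_shift_le k (k.+1 * N) r; rewrite [(_ * _ + r)%N]addnC -mE.
  by move: cardE good_card; lia.
have binE : (k.+1 * 'C(m + k.+1, k.+1) = (m + k.+1) * 'C(m + k, k))%N.
  by rewrite addnS mul_bin_diag.
have C0 : 0 < 'C(m + k.+1, k.+1)%:R :> R by rewrite ltr0n bin_gt0 leq_addl.
rewrite mulrC ler_pdivrMr //; apply: le_trans sum_le _.
rewrite mulrDl lerD2l mulrAC ler_pdivlMr ?ltr0n ?addnS // -!natrM ler_nat.
rewrite -addnS -mulnA binE; move: bad_le; rewrite
  -(leq_pmul2l (m := m + k.+1)) ?addnS //.
by rewrite mulnCA mulnC.
Qed.

Lemma simplex_average_cvg k (u : ('I_k -> nat) -> R) l : (0 < k)%N ->
  antitone u -> (forall q, 0 <= u q <= 1) -> is_glb u l ->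
  (fun m => (('C(m + k, k)%:R)^-1 *
     \sum_(q : {ffun 'I_k -> 'I_m.+1} | (\sum_(i < k) q i <= m)%N)
        u (fun i => q i))%:C : R[i]) @ \oo --> (l%:C : R[i]).
Proof.
move=> k0 u_anti u01 [lu ul].
have sumE m : \sum_(q : {ffun 'I_k -> 'I_m.+1} | (\sum_(i < k) q i <= m)%N)
    u (fun i => q i) = \sum_(q in simplex k m) u (fun i => q i).
  by apply: eq_bigl => q; rewrite inE.
apply: cvg_above => [m|e e0].
  rewrite sumE mulrC ler_pdivlMr ?ltr0n ?bin_gt0 ?leq_addl //.
  rewrite -card_simplex mulr_natr -sumr_const; apply: ler_sum => q _.
  exact: lu.
have e2 : 0 < e / 2 by rewrite divr_gt0.
have [p pe] := ul _ e2; pose N := \max_(i < k) p i.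
have uN : u (fun=> N) < l + e / 2.
  by apply: le_lt_trans pe; apply: u_anti => i; exact: leq_bigmax.
pose K : R := (k * N * k)%:R; pose m0 := (maxn (k * N) (Num.bound (K / (e / 2)))).
exists m0 => m; rewrite geq_max => /andP[kNm Km]; rewrite sumE.
apply: le_lt_trans (simplex_average_le k0 kNm u_anti u01) _.
rewrite [e]splitr addrA; apply: ltrD uN _.
rewrite ltr_pdivrMr ?ltr0n ?addn_gt0 ?k0 ?orbT // -/K mulrC -ltr_pdivrMr //.
apply: lt_le_trans (archi_boundP _) _; first by rewrite divr_ge0 // ltW.
by rewrite ler_nat (leq_trans Km) // leq_addr.
Qed.

End SimplexAverages.

(** * Sums over multiwords of given or bounded lengths *)

Section WordSums.
Variables (k : nat) (n : 'I_k -> nat).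
Local Notation words := (words n).
Implicit Types (p q : 'I_k -> nat) (a b : words).

Definition empty_words : words := [ffun i => [::]].

Lemma upto0 a : upto (fun=> 0%N) a = (a == empty_words).
Proof.
apply/forallP/eqP => [a0|-> i]; last by rewrite ffunE.
by apply/ffunP => i; rewrite ffunE; apply/nilP; rewrite /nilp -leqn0; exact: a0.
Qed.

Section Enumeration.
Variables (F : 'I_k -> finType) (v : forall i, F i -> seq 'I_(n i)).
Hypothesis v_inj : forall i, injective (@v i).

Definition words_of (f : {dffun forall i, F i}) : words := [ffun i => v (f i)].

Lemma words_of_inj : injective words_of.
Proof.
move=> f g /ffunP fg; apply/ffunP => i; apply: v_inj.
by have := fg i; rewrite !ffunE.
Qed.

(** Conditions imposed on each coordinate separately cut out products of finite
    types: bounded sequences for [upto], tuples for [level]. *)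
Definition words_enum : seq words :=
  [seq words_of f | f <- enum {dffun forall i, F i}].

Lemma words_enum_uniq : uniq words_enum.
Proof. by rewrite map_inj_uniq ?enum_uniq //; exact: words_of_inj. Qed.

Lemma size_words_enum : size words_enum = (\prod_i #|F i|)%N.
Proof. by rewrite size_map -cardE card_dep_ffun foldrE big_map big_enum. Qed.

Lemma mem_words_enum (P : forall i, pred (seq 'I_(n i))) a :
  (forall i (x : F i), P i (v x)) ->
  (forall i w, P i w -> exists x : F i, v x == w) ->
  (a \in words_enum) = [forall i, P i (a i)].
Proof.
move=> vP Pv; apply/mapP/forallP => [[f _ ->] i|aP]; first by rewrite ffunE.
pose f : {dffun forall i, F i} := [ffun i => xchoose (Pv i (a i) (aP i))].
exists f; first by rewrite mem_enum.
by apply/ffunP => i; rewrite !ffunE (eqP (xchooseP (Pv i (a i) (aP i)))).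
Qed.

End Enumeration.

Definition upto_seq q : seq words :=
  @words_enum (fun i => {bseq (q i) of 'I_(n i)}) (fun i x => bseqval x).

Lemma upto_seq_uniq q : uniq (upto_seq q).
Proof. by apply: words_enum_uniq => i x y; exact: val_inj. Qed.

Lemma mem_upto_seq q a : (a \in upto_seq q) = upto q a.
Proof.
apply: (@mem_words_enum _ _ (fun i w => size w <= q i)%N) => [i x|i w wq].
  exact: size_bseq.
by exists (Bseq wq).
Qed.

Lemma big_upto_eq (V : nmodType) (t : words -> V) (P P' : pred words) q q' :
  (forall a, upto q a && P a = upto q' a && P' a) ->
  \sum_(a <- upto_seq q | P a) t a = \sum_(a <- upto_seq q' | P' a) t a.
Proof.
move=> PP'; rewrite -big_filter -[RHS]big_filter; apply: perm_big.
apply: uniq_perm; rewrite ?filter_uniq ?upto_seq_uniq // => a.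
by rewrite !mem_filter !mem_upto_seq ![_ && upto _ _]andbC PP'.
Qed.

Lemma level_upto q a : level q a -> upto q a.
Proof. by move=> /forallP aq; apply/forallP => i; rewrite (eqP (aq i)). Qed.

Definition level_seq q : seq words := [seq a <- upto_seq q | level q a].

Lemma level_seq_uniq q : uniq (level_seq q).
Proof. by rewrite filter_uniq // upto_seq_uniq. Qed.

Lemma mem_level_seq q a : (a \in level_seq q) = level q a.
Proof. by rewrite mem_filter mem_upto_seq andb_idr //; exact: level_upto. Qed.

Lemma size_level_seq q : size (level_seq q) = (\prod_i n i ^ q i)%N.
Proof.
pose s := @words_enum (fun i => (q i).-tuple 'I_(n i)) (fun i x => tval x).
have -> : size (level_seq q) = size s.
  apply/perm_size/uniq_perm; first exact: level_seq_uniq.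
    by apply: words_enum_uniq => i x y; exact: val_inj.
  move=> a; rewrite mem_level_seq; apply/esym.
  apply: (@mem_words_enum _ _ (fun i w => size w == q i)) => [i x|i w wq].
    by rewrite size_tuple.
  by exists (Tuple wq).
by rewrite size_words_enum; apply: eq_bigr => i _; rewrite card_tuple card_ord.
Qed.

Lemma prepend_inj i (j l : 'I_(n i)) a b :
  prepend j a = prepend l b -> j = l /\ a = b.
Proof.
move=> ab; split; first by apply: Some_inj;
  rewrite -(prepend_head j a) ab prepend_head.
by rewrite -(prependK j a) ab prependK.
Qed.

Lemma level_prepend q i (j : 'I_(n i)) a :
  level (upd q i (q i).+1) (prepend j a) = level q a.
Proof.
apply: eq_forallb => s; rewrite ffunE /upd; have [->|si] := eqVneq s i.
  by rewrite dfwith_in.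
by rewrite dfwith_out // eq_sym.
Qed.

Lemma level_seqS q i : perm_eq (level_seq (upd q i (q i).+1))
  [seq prepend j a | j <- enum 'I_(n i), a <- level_seq q].
Proof.
apply: uniq_perm; first exact: level_seq_uniq.
  apply: allpairs_uniq; rewrite ?enum_uniq ?level_seq_uniq //.
  by move=> [j a] [l b] _ _ /= /prepend_inj[-> ->].
move=> a; rewrite mem_level_seq; apply/idP/allpairsP => [aq|[[j b] [_ bq ->]]].
  have := forallP aq i; rewrite /upd eqxx; case ai : (a i) => [//|j w] _.
  have aj : ohead (a i) = Some j by rewrite ai.
  exists (j, strip i a); rewrite /= stripK //; split=> //;
    first by rewrite mem_enum.
  by rewrite mem_level_seq -(level_prepend q j) stripK.
by rewrite level_prepend -mem_level_seq.
Qed.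

Variable R : realType.
Implicit Types t : words -> R.

Definition level_average t q : R :=
  (\sum_(a <- level_seq q) t a) / (\prod_i n i ^ q i)%:R.

Definition upto_average t q : R :=
  (\sum_(a <- upto_seq q) t a) / (\prod_(i < k) \sum_(j < (q i).+1) n i ^ j)%N%:R.

Lemma antitone_step (u : ('I_k -> nat) -> R) :
  (forall q i, u (upd q i (q i).+1) <= u q) -> antitone u.
Proof.
move=> u_step p q pq; have [m] := ubnP (\sum_i (q i - p i))%N.
elim: m => // m IHm in q pq *; rewrite ltnS => qm.
have [qp|/existsP[i pi]] : (forall i, q i <= p i)%N \/ [exists i, p i < q i]%N.
  have [|/existsPn h] := boolP [exists i, p i < q i]%N; [by right|left=> i].
  by rewrite leqNgt h.
- by rewrite (_ : q = p) //; apply/funext => i; apply/eqP; rewrite eqn_leq pq qp.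
have qE : q = upd (upd q i (q i).-1) i (upd q i (q i).-1 i).+1.
  by rewrite upd_upd updE prednK ?upd_id //; exact: leq_ltn_trans pi.
rewrite qE; apply: le_trans (u_step _ i) _; apply: IHm => [s|].
  rewrite /upd; case: eqP => [->|_]; last exact: pq.
  by rewrite -ltnS prednK //; exact: leq_ltn_trans pi.
apply: leq_trans qm; rewrite [leqRHS](bigD1 i) //= [in ltnLHS](bigD1 i) //= updE.
rewrite -addSn leq_add //; first by move: pi; lia.
by apply: leq_sum => s /negPf si; rewrite /upd si.
Qed.

Hypothesis n_gt0 : forall i, (0 < n i)%N.

Let npos q : 0 < (\prod_i n i ^ q i)%N%:R :> R.
Proof. by rewrite ltr0n prodn_gt0 // => i; rewrite expn_gt0 n_gt0. Qed.

(** Lengthening coordinate [i] by one multiplies the number of words by [n i],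
    and the [n i] words over a given one have no larger weight than it. *)
Lemma level_average_antitone t :
  (forall i (j : 'I_(n i)) a, t (prepend j a) <= t a) -> antitone (level_average t).
Proof.
move=> t_le; apply: antitone_step => q i; rewrite /level_average.
rewrite ler_pdivrMr // mulrAC ler_pdivlMr
  // (perm_big _ (level_seqS q i)) big_allpairs_dep.
have -> : (\prod_s n s ^ upd q i (q i).+1 s = n i * \prod_s n s ^ q s)%N.
  rewrite (bigD1 i) //= [in RHS](bigD1 i) //= updE expnS -mulnA.
  by congr (_ * (_ * _))%N; apply: eq_bigr => s /negPf si; rewrite /upd si.
rewrite natrM mulrA ler_wpM2r ?ler0n // mulr_natr big_enum /=.
rewrite -[X in _ *+ X]card_ord -sumr_const; apply: ler_sum => j _.
exact: ler_sum.
Qed.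

Lemma level_average_bounds t : (forall a, 0 <= t a <= 1) ->
  forall q, 0 <= level_average t q <= 1.
Proof.
move=> t01 q; rewrite /level_average divr_ge0 ?ler0n ?sumr_ge0 //=; last first.
  by move=> a _; case/andP: (t01 a).
rewrite ler_pdivrMr // mul1r -size_level_seq -sum1_size natr_sum.
by apply: ler_sum => a _; case/andP: (t01 a).
Qed.

Definition letter_weight (i : 'I_k) (j : nat) : R := (n i ^ j)%:R.

Lemma letter_weight_ge1 i j : 1 <= letter_weight i j.
Proof. by rewrite ler1n expn_gt0 n_gt0. Qed.

(** Averaging over the words of length at most [q] amounts to averaging the
    level averages along each coordinate in turn, with geometric weights. *)
Lemma averages_levels t s q : uniq s ->
  foldr (average letter_weight) (level_average t) s q =
  (\sum_(a <- upto_seq q | [forall i, (i \in s) || (size (a i) == q i)]) t a) /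
  (\prod_i (if i \in s then \sum_(j < (q i).+1) n i ^ j else n i ^ q i))%N%:R.
Proof.
elim: s q => [|i s IHs] q /=.
  move=> _; rewrite /level_average /level_seq big_filter; congr (_ / _).
move=> /andP[iNs s_uniq]; rewrite {1}/average.
pose D (q : 'I_k -> nat) i :=
  (if i \in s then \sum_(j < (q i).+1) n i ^ j else n i ^ q i)%N.
pose D' : R := (\prod_(l | l != i) D q l)%N%:R.
pose S q := \sum_(a <- upto_seq q | [forall l,
  (l \in s) || (size (a l) == q l)]) t a.
have termE j : letter_weight i j *
    foldr (average letter_weight) (level_average t) s (upd q i j) =
    S (upd q i j) / D'.
  rewrite IHs // (bigD1 i) //= (negPf iNs) updE natrM.
  rewrite (eq_bigr (D q)); last by move=> l /negPf li; rewrite /D /upd li.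
  rewrite invfM mulrCA [in X in _ * X]mulrA mulfV ?mul1r //.
  by rewrite gt_eqF // (lt_le_trans ltr01) // letter_weight_ge1.
rewrite (eq_bigr (fun j : 'I__ => S (upd q i j) / D')); last by move=> j _;
  exact: termE.
rewrite -mulr_suml -mulrA -invfM; congr (_ / _).
  rewrite
    (partition_big (fun a : words => inord (size (a i)) : 'I_(q i).+1) xpredT) //=.
  apply: eq_bigr => j _; apply: big_upto_eq => a.
  apply/andP/andP => [[/forallP aq /forallP al]|[/forallP aq /andP[/forallP al
    /eqP aj]]].
    have aij : size (a i) = j.
      by have := al i; rewrite (negPf iNs) /= updE => /eqP.
    split.
      apply/forallP => l; have := aq l; rewrite /upd; have [->|//] := eqVneq l i.
      by move=> _; rewrite aij -ltnS.
    rewrite aij inord_val eqxx andbT; apply/forallP => l.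
    by rewrite inE; have := al l; rewrite /upd; have [//|_] := eqVneq l i.
  have aij : size (a i) = j by rewrite -aj inordK // ltnS.
  split; apply/forallP => l.
    by rewrite /upd; have [->|_] := eqVneq l i; rewrite ?aij.
  have := al l; rewrite inE /upd; have [->|//] := eqVneq l i.
  by rewrite aij eqxx orbT.
rewrite (bigD1 i) //= inE eqxx /= natrM natr_sum mulrC; congr (_ * _).
congr (_%:R); apply: eq_bigr => l li; rewrite inE (negPf li) //.
Qed.

Lemma averages_level_average t :
  foldr (average letter_weight) (level_average t) (enum 'I_k) = upto_average t.
Proof.
apply/funext => q; rewrite averages_levels ?enum_uniq //; congr (_ / _%:R).
  by apply: eq_bigl => a; apply/forallP => i; rewrite mem_enum.
by apply: eq_bigr => i _; rewrite mem_enum.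
Qed.

(** Averages of the constant 1 are 1, so comparing with [averages_levels] counts
    the words. *)
Lemma size_upto_seq q : size (upto_seq q) =
  (\prod_(i < k) \sum_(j < (q i).+1) n i ^ j)%N.
Proof.
have sum1E (r : seq words) : \sum_(a <- r) 1 = (size r)%:R :> R.
  by rewrite -sum1_size natr_sum.
have one p : level_average (fun=> 1) p = 1.
  by rewrite /level_average sum1E size_level_seq divff // gt_eqF.
have one_s s p : foldr (average letter_weight) (level_average (fun=> 1)) s p = 1.
  elim: s p => [|i s IHs] p //=; rewrite {1}/average.
  under eq_bigr do rewrite IHs mulr1.
  by rewrite divff // gt_eqF // weight_gt0 //; exact: letter_weight_ge1.
have := one_s (enum 'I_k) q; rewrite averages_level_average /upto_average.
rewrite sum1E => /(congr1 ( *%R^~ (\prod_(i < k) \sum_(j < (q i).+1) n i ^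
  j)%N%:R)).
rewrite mul1r divfK => [/eqP|]; first by rewrite eqr_nat => /eqP.
rewrite pnatr_eq0 -lt0n prodn_gt0 // => i.
by rewrite big_ord_recl expn0.
Qed.

Lemma upto_average_antitone t :
  (forall i (j : 'I_(n i)) a, t (prepend j a) <= t a) -> antitone (upto_average t).
Proof.
move=> t_le; rewrite -averages_level_average; apply: averages_antitone.
  exact: letter_weight_ge1.
exact: level_average_antitone.
Qed.

Lemma upto_average_glb t l :
  (forall i (j : 'I_(n i)) a, t (prepend j a) <= t a) ->
  is_glb (level_average t) l -> is_glb (upto_average t) l.
Proof.
move=> t_le tl; rewrite -averages_level_average; apply: averages_glb => //.
  exact: letter_weight_ge1.
exact: level_average_antitone.
Qed.

End WordSums.

(** * Creation operators on the Fock space *)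

Section L2Facts.
Variables (R : realType) (X : choiceType) (V : hilbertType R).
Local Notation C := R[i].
Implicit Types f g : l2 X V.

Lemma l2_ext f g : (forall x, f x = g x) -> f = g.
Proof. by move=> fg; apply/val_inj/funext. Qed.

Lemma l2_sumE (J : Type) (s : seq J) (f : J -> l2 X V) x :
  (\sum_(j <- s) f j) x = \sum_(j <- s) f j x.
Proof. by elim: s => [|j s IHs]; rewrite ?big_nil ?big_cons // l2_addE IHs. Qed.

Lemma l2_dot_ext (W : hilbertType R) (f g : l2 X V) (f' g' : l2 X W) :
  (forall x, '[f x, g x] = '[f' x, g' x]) -> '[f, g] = '[f', g'].
Proof.
move=> fg; change (l2_dot f g = l2_dot f' g'); rewrite /l2_dot.
by under eq_fun do rewrite fg.
Qed.

Lemma coord_proj_sa (D : pred X) f g : '[coord_proj D f, g] = '[f, coord_proj D g].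
Proof.
apply: l2_dot_ext => x; rewrite !coord_projE.
by case: ifP; rewrite ?hdot0l ?hdot0r.
Qed.

Lemma coord_proj_idem (D : pred X) f : coord_proj D (coord_proj D f) =
  coord_proj D f.
Proof. by apply: l2_ext => x; rewrite !coord_projE; case: (D x). Qed.

End L2Facts.

Section FockOperators.
Variables (R : realType) (k : nat) (n : 'I_k -> nat).
Local Notation C := R[i].
Local Notation words := (words n).
Local Notation fock := (fock R n).
Local Notation e := (@unit_vec R k n).
Implicit Types (f g : fock) (a b c : words) (i : 'I_k).

Lemma fock_addE f g a : (f + g) a = f a + g a. Proof. by []. Qed.
Lemma fock_scaleE (z : C) f a : (z *: f) a = z * f a. Proof. by []. Qed.
Lemma fock_subE f g a : (f - g) a = f a - g a. Proof. by []. Qed.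
Lemma fock_ext f g : (forall a, f a = g a) -> f = g. Proof. exact: l2_ext. Qed.
Lemma fock_sumE (J : Type) (s : seq J) (f : J -> fock) a :
  (\sum_(j <- s) f j) a = \sum_(j <- s) f j a.
Proof. exact: l2_sumE. Qed.

Lemma hdot_unit_vec f a : '[f, e a] = f a.
Proof.
apply: l2_dot_unique.
apply: cvg_near_cst; exists [fset a]%fset => // A /= aA.
have aA' : a \in A by apply: (fsubsetP aA); rewrite !inE.
rewrite (big_fsetD1 a) //= /scalar_dot unit_vecE eqxx conjC1 mulr1.
rewrite big_seq big1 ?addr0 // => b.
by rewrite !inE => /andP[/negPf ba _]; rewrite unit_vecE ba conjC0 mulr0.
Qed.

Lemma unit_vec_dot a b : '[e a, e b] = (b == a)%:R.
Proof. by rewrite hdot_unit_vec unit_vecE. Qed.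

Lemma coord_proj_finite (s : seq words) (D : pred words) f : uniq s ->
  (forall a, D a = (a \in s)) -> coord_proj D f = \sum_(a <- s) f a *: e a :> fock.
Proof.
move=> s_uniq Ds; apply: fock_ext => b; rewrite coord_projE fock_sumE Ds.
case: ifP => bs.
  rewrite (bigD1_seq b) // fock_scaleE unit_vecE eqxx big1 => [|a ab].
    by rewrite mulr1 /= addr0.
  by rewrite fock_scaleE unit_vecE eq_sym (negPf ab) mulr0.
rewrite big_seq big1 // => a ain; rewrite fock_scaleE unit_vecE.
have [ba|_] := eqVneq b a; last by rewrite mulr0.
by move: bs; rewrite ba ain.
Qed.

Lemma sqsummable_prepend i (j : 'I_(n i)) f :
  sqsummable (fun a : words => f (prepend j a)).
Proof.
have [M fM] := l2P f; exists M => A.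
apply: le_trans (fM [fset prepend j a | a in A]%fset).
by rewrite big_imfset //= => a b _ _ /prepend_inj[].
Qed.

Definition annihilation i (j : 'I_(n i)) f : fock :=
  to_l2 (fun a : words => f (prepend j a)).

Lemma annihilationE i (j : 'I_(n i)) f a : annihilation j f a = f (prepend j a).
Proof. by rewrite /annihilation to_l2E //; exact: sqsummable_prepend. Qed.

(** Removing the letter [j] sends the finite sets of words cofinally to finite
    sets of words, and turns the partial sums of one side into those of the
    other. *)
Lemma creation_annihilation i (j : 'I_(n i)) f g :
  '[creation j f, g] = '[f, annihilation j g].
Proof.
pose P a := ohead (a i) == Some j.
pose strips (A : {fset words}) := [fset strip i a | a in [fset b in A | P b]]%fset.
have stripsE (A : {fset words}) :
    \sum_(a <- A) '[creation j f a, g a] = \sum_(b <- strips A) '[f b,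
      annihilation j g b].
  have PA a : a \in [fset b in A | P b]%fset -> ohead (a i) = Some j.
    by rewrite !inE => /andP[_ /eqP].
  rewrite big_imfset /=; last first.
    by move=> a b /PA aj /PA bj ab; rewrite -(stripK aj) ab stripK.
  rewrite (big_fsetID _ P A) /= [X in _ + X]big_seq [X in _ + X]big1 ?addr0 => [|a].
    rewrite big_seq [RHS]big_seq; apply: eq_bigr => a /PA aj.
    by rewrite creationE aj eqxx annihilationE stripK.
  by rewrite !inE creationE /P => /andP[_ /negPf->]; rewrite hdot0l.
apply: l2_dot_unique; rewrite (funext stripsE).
apply: cvg_comp (@l2_dot_cvg _ _ _ f (annihilation j g)).
move=> U [A0 _ A0U]; exists [fset prepend j a | a in A0]%fset => // A /= A0A.
apply: A0U => /=; apply/fsubsetP => b bA0; apply/imfsetP;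
  exists (prepend j b) => /=.
  rewrite !inE /P prepend_head eqxx andbT; apply: (fsubsetP A0A).
  by apply/imfsetP; exists b.
by rewrite prependK.
Qed.

Lemma creation_linear i (j : 'I_(n i)) : linear (@creation R k n i j).
Proof.
move=> a f g; apply: fock_ext => b.
rewrite creationE !fock_addE !fock_scaleE !creationE.
by case: ifP; rewrite ?mulr0 ?addr0.
Qed.

Lemma creationD i (j : 'I_(n i)) f g : creation j (f + g) =
  creation j f + creation j g.
Proof. by have := creation_linear j 1 f g; rewrite !scale1r. Qed.

Lemma creationB i (j : 'I_(n i)) f g : creation j (f - g) =
  creation j f - creation j g.
Proof. by have := creation_linear j (-1) g f;
  rewrite !scaleN1r ![- _ + _]addrC. Qed.

Lemma creationZ i (j : 'I_(n i)) (z : C) f :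
  creation j (z *: f) = z *: creation j f.
Proof.
have c0 : creation j (0 : fock) = 0 by have := creationB j 0 0; rewrite !subrr.
by have := creation_linear j z f 0; rewrite c0 !addr0.
Qed.

Lemma creation_norm i (j : 'I_(n i)) f : `|creation j f| = `|f|.
Proof.
apply/eqP; rewrite -(@eqrXn2 _ 2) // -!hdotxx creation_annihilation; apply/eqP.
congr '[_, _]; apply: fock_ext => a.
by rewrite annihilationE creationE prepend_head eqxx prependK.
Qed.

Lemma strip_eq i a : strip i a i = behead (a i).
Proof. by rewrite ffunE dfwith_in. Qed.

Lemma strip_neq i s a : s != i -> strip i a s = a s.
Proof. by move=> si; rewrite ffunE dfwith_out // eq_sym. Qed.

Lemma creation_commute (s t : 'I_k) (j : 'I_(n s)) (l : 'I_(n t)) f : s != t ->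
  creation j (creation l f) = creation l (creation j f).
Proof.
move=> st; apply: fock_ext => a; rewrite !creationE.
have ts : t != s by rewrite eq_sym.
rewrite (strip_neq a ts) (strip_neq a st).
have -> : strip t (strip s a) = strip s (strip t a).
  apply/ffunP => r; have [->|tr] := eqVneq r t.
    by rewrite strip_eq !(strip_neq _ ts) strip_eq.
  have [->|sr] := eqVneq r s; first by rewrite (strip_neq _ st) !strip_eq strip_neq.
  by rewrite !(strip_neq _ tr, strip_neq _ sr).
by case: ifP => _; case: ifP.
Qed.

Definition prefix_at i (w : seq 'I_(n i)) a : words := finfun (dfwith a (w ++ a i)).

Lemma prefix_at_eq i (w : seq 'I_(n i)) a : prefix_at w a i = w ++ a i.
Proof. by rewrite ffunE dfwith_in. Qed.

Lemma prefix_at_neq i (w : seq 'I_(n i)) a s : s != i -> prefix_at w a s = a s.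
Proof. by move=> si; rewrite ffunE dfwith_out // eq_sym. Qed.

Lemma prefix_at_nil i a : @prefix_at i [::] a = a.
Proof.
apply/ffunP => s; have [->|si] := eqVneq s i; first by rewrite prefix_at_eq.
by rewrite prefix_at_neq.
Qed.

Lemma prefix_at_cons i (j : 'I_(n i)) w a :
  prefix_at (j :: w) a = prepend j (prefix_at w a).
Proof.
apply/ffunP => s; have [->|si] := eqVneq s i.
  by rewrite prefix_at_eq ffunE dfwith_in prefix_at_eq.
by rewrite prefix_at_neq // ffunE dfwith_out ?prefix_at_neq // eq_sym.
Qed.

(** The stages of [words_op] and [words_adj], which treat one coordinate after
    another. *)
Definition prefix_on (s : seq 'I_k) a c : words :=
  [ffun i => if i \in s then a i ++ c i else c i].

Lemma prefix_on_nil a c : prefix_on [::] a c = c.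
Proof. by apply/ffunP => i; rewrite ffunE. Qed.

Lemma prefix_on_all a : prefix_on (enum 'I_k) a (empty_words n) = a.
Proof. by apply/ffunP => i; rewrite !ffunE mem_enum cats0. Qed.

Lemma prefix_on_consl i s a c : i \notin s ->
  prefix_on (i :: s) a c = prefix_at (a i) (prefix_on s a c).
Proof.
move=> /negPf is_; apply/ffunP => r; rewrite ffunE inE.
have [->|ri] := eqVneq r i; first by rewrite prefix_at_eq ffunE is_.
by rewrite prefix_at_neq // ffunE.
Qed.

Lemma prefix_on_consr i s a c : i \notin s ->
  prefix_on (i :: s) a c = prefix_on s a (prefix_at (a i) c).
Proof.
move=> /negPf is_; apply/ffunP => r; rewrite [LHS]ffunE [RHS]ffunE inE.
have [->|ri] := eqVneq r i; first by rewrite is_ prefix_at_eq.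
by rewrite prefix_at_neq.
Qed.

Lemma word_op_creation i (w : seq 'I_(n i)) (z : C) c :
  word_op (@creation R k n) w (z *: e c) = z *: e (prefix_at w c).
Proof.
elim: w => [|j w IHw] /=; first by rewrite prefix_at_nil.
by rewrite IHw creationZ creation_unit_vec prefix_at_cons.
Qed.

Lemma words_op_creation a (z : C) :
  words_op (@creation R k n) a (z *: e (empty_words n)) = z *: e a.
Proof.
suff H s : uniq s ->
  foldr (fun i => word_op (@creation R k n) (a i)) (z *: e (empty_words n)) s
    = z *: e (prefix_on s a (empty_words n)).
  by rewrite /words_op H ?enum_uniq // prefix_on_all.
elim: s => [|i s IHs] /=; first by rewrite prefix_on_nil.
move=> /andP[is_ s_uniq].
by rewrite IHs // word_op_creation prefix_on_consl.
Qed.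

End FockOperators.

(** * Compression to the orthogonal of an invariant subspace *)

Opaque creation annihilation coord_proj unit_vec to_l2 gauge.

Lemma creation_proj_annihilationE (R : realType) (k : nat) (n : 'I_k -> nat)
  i (D : pred (words n)) (f : fock R n) (a : words n) :
  \sum_(j < n i) creation j (coord_proj D (annihilation j f)) a =
  if ~~ nilp (a i) && D (strip i a) then f a else 0.
Proof.
have termE (j : 'I_(n i)) : creation j (coord_proj D (annihilation j f)) a =
    if (ohead (a i) == Some j) && D (strip i a) then f a else 0.
  rewrite creationE; case: eqP => // aj.
  by rewrite coord_projE annihilationE stripK.
rewrite (eq_bigr _ (fun j _ => termE j)); move: (f a) (D _) => z d.
case: (a i) => [|j w]; first by rewrite big1.
rewrite (bigD1 j) // big1 ?addr0; first by rewrite eqxx /= addr0.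
by move=> l lj; rewrite /= (inj_eq Some_inj) eq_sym (negPf lj).
Qed.

Section Compression.
Variables (R : realType) (k : nat) (n : 'I_k -> nat).
Variable M : closed_subspace (fock R n).
Hypothesis M_invariant : creation_invariant M.
Local Notation C := R[i].
Local Notation words := (words n).
Local Notation fock := (fock R n).
Local Notation e := (@unit_vec R k n).
Local Notation N := (orth M).
Local Notation P := (orth_proj (orth M)).
Local Notation T := (compression M).
Local Notation empty := (empty_words n).
Implicit Types (f g : fock) (a b c : words) (i : 'I_k) (x y : sub_hilbert (orth M)).

Lemma orth_proj_kills f : (M : set fock) f -> P f = 0.
Proof. by move=> Mf; rewrite orth_proj_orth orth_proj_id // subrr. Qed.

(** [creation j] maps what [P] discards into [M], where [P] vanishes. *)
Lemma orth_proj_creation i (j : 'I_(n i)) f :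
  P (creation j (P f)) = P (creation j f).
Proof.
apply/eqP; rewrite eq_sym -subr_eq0 -orth_projB -creationB orth_proj_kills //.
apply: M_invariant; rewrite orth_proj_orth opprB addrC subrK.
exact: orth_proj_in.
Qed.

Lemma compressionE i (j : 'I_(n i)) x : val (T i j x) = P (creation j (val x)).
Proof. by []. Qed.

Lemma val_orth_proj x : P (val x) = val x.
Proof. by apply: orth_proj_id; exact: sub_hilbertP. Qed.

(** The weights [|P e_a|^2] on words, of which every quantity of the theorem
    is an average. *)
Definition mass a : R := sqnorm (P (e a)).

Lemma massE a : (mass a)%:C = '[P (e a), e a].
Proof. by rewrite sqnormE (hdot_orth_projr _ (orth_proj_in _ _)). Qed.

(** [P S_{i,j} e_a = P S_{i,j} P e_a], and neither [P] nor [S_{i,j}] increases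
    norms. *)
Lemma mass_prepend i (j : 'I_(n i)) a : mass (prepend j a) <= mass a.
Proof.
rewrite /mass -creation_unit_vec -orth_proj_creation.
apply: le_trans (orth_proj_sqnorm_le _ _) _.
by rewrite /sqnorm creation_norm.
Qed.

Lemma mass_bounds a : 0 <= mass a <= 1.
Proof.
rewrite sqnorm_ge0 /=; apply: le_trans (orth_proj_sqnorm_le _ _) _.
by rewrite -lecR sqnormE unit_vec_dot eqxx.
Qed.

Lemma annihilation_orth i (j : 'I_(n i)) f : (N : set fock) f ->
  (N : set fock) (annihilation j f).
Proof.
move=> Nf m Mm; rewrite hdotC -creation_annihilation hdotC Nf ?rmorph0 //.
exact: M_invariant.
Qed.

Definition compression_adj i (j : 'I_(n i)) x : sub_hilbert (orth M) :=
  proj_sub (orth M) (annihilation j (val x)).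

Lemma val_compression_adj i (j : 'I_(n i)) x :
  val (compression_adj j x) = annihilation j (val x).
Proof. by apply: orth_proj_id; apply/annihilation_orth/sub_hilbertP. Qed.

Lemma compression_dot i (j : 'I_(n i)) x y :
  '[T i j x, y] = '[x, compression_adj j y].
Proof.
change ('[P (creation j (val x)), val y] = '[val x, val (compression_adj j y)]).
rewrite val_compression_adj (hdot_orth_projl _ (sub_hilbertP y)).
exact: creation_annihilation.
Qed.

Lemma adjoint_compression i (j : 'I_(n i)) : adjoint (T i j) = compression_adj j.
Proof. by apply: adjoint_eq => x y; exact: compression_dot. Qed.

Lemma compression_bounded i (j : 'I_(n i)) : bounded_linear (T i j).
Proof.
apply: bounded_linear_norm_le => [z x y|x].
  apply: val_inj; rewrite compressionE.
  change (P (creation j (z *: val x + val y)) =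
    z *: P (creation j (val x)) + P (creation j (val y))).
  by rewrite creationD creationZ orth_projD orth_projZ.
change (`|val (T i j x)| <= `|val x|); rewrite compressionE.
by apply: le_trans (orth_proj_norm_le _ _) _; rewrite creation_norm.
Qed.

Lemma compression_commute (s t : 'I_k) (j : 'I_(n s)) (l : 'I_(n t)) : s != t ->
  T s j \o T t l = T t l \o T s j.
Proof.
move=> st; apply/funext => x; apply: val_inj.
apply: etrans (orth_proj_creation j (creation l (val x))) _.
apply: etrans _ (esym (orth_proj_creation l (creation j (val x)))).
exact: (congr1 P (creation_commute j l (val x) st)).
Qed.

Definition vacuum_on (p : 'I_k -> bool) (s : seq 'I_k) : pred words :=
  fun a => all (fun i => p i ==> nilp (a i)) s.

(** Since [P S_{i,j} P = P S_{i,j}] and the adjoint of [S_{i,j}] maps [N] into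
    itself, the defect operators of the compression are the compressions of those
    of [S]; and [id - sum_j S_{i,j} S_{i,j}^*] is the projection onto the words
    with empty [i]-th coordinate. *)
Lemma defect_ofE (p : 'I_k -> bool) x :
  val (defect_of T p x) = P (coord_proj (vacuum_on p (enum 'I_k)) (val x)).
Proof.
suff H s : uniq s -> forall x, val (foldr (fun i Y =>
    if p i then fun h => Y h - Phi T i Y h else Y) id s x) =
    P (coord_proj (vacuum_on p s) (val x)) by exact: (H _ (enum_uniq _)).
elim: s => [_ {}x|i s IHs /andP[is_ s_uniq] {}x].
  rewrite (_ : coord_proj _ _ = val x) ?val_orth_proj //.
  by apply: fock_ext => a; rewrite coord_projE.
rewrite [foldr _ _ _]/=; set Y := foldr _ _ _ in IHs *.
have {}IHs := IHs s_uniq; case: ifP => pi; last first.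
  by rewrite IHs; congr (P _); apply: fock_ext => a; rewrite !coord_projE /= pi.
change (val (Y x) - val (Phi T i Y x) = P (coord_proj (vacuum_on p (i :: s))
  (val x))).
rewrite /Phi val_sum IHs.
rewrite (eq_bigr (fun j => P (creation j (coord_proj (vacuum_on p s)
  (annihilation j (val x)))))); last first.
  move=> j _; rewrite adjoint_compression compressionE IHs val_compression_adj.
  exact: orth_proj_creation.
rewrite -orth_proj_sum -orth_projB; congr (P _); apply: fock_ext => a.
rewrite fock_subE fock_sumE creation_proj_annihilationE !coord_projE.
have -> : vacuum_on p s (strip i a) = vacuum_on p s a.
  apply: eq_in_all => r rs; rewrite strip_neq //.
  by apply: contraNneq is_ => <-.
rewrite [vacuum_on p (i :: s) a]/= pi -/(vacuum_on p s a).
case: (nilp (a i)) (vacuum_on p s a) => -[]; by rewrite ?subr0 ?subrr.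
Qed.

Lemma defect_of_positive p : positive_op (defect_of T p).
Proof.
move=> x; change (0 <= '[val (defect_of T p x), val x]).
rewrite defect_ofE hdot_orth_projl; last exact: sub_hilbertP.
rewrite -coord_proj_idem coord_proj_sa hdotxx exprn_ge0 //.
Qed.

Lemma compression_in_polyball : in_polyball T.
Proof.
split; [exact: compression_bounded|exact: compression_commute|].
exact: defect_of_positive.
Qed.

Definition vacuum : sub_hilbert (orth M) := proj_sub (orth M) (e empty).

Lemma defectE x : defect T x = (val x : fock) empty *: vacuum.
Proof.
apply: val_inj; change (val (defect T x) = (val x : fock) empty *: P (e empty)).
rewrite defect_ofE -orth_projZ; congr (P _); apply: fock_ext => a.
rewrite coord_projE fock_scaleE unit_vecE -upto0.
have -> : vacuum_on xpredT (enum 'I_k) a = upto (fun=> 0%N) a.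
  apply/allP/forallP => [h i|h i _]; last by rewrite /nilp -leqn0; exact: h.
  by have := h i; rewrite mem_enum leqn0; apply.
case: ifP => [|_]; last by rewrite mulr0.
by rewrite upto0 => /eqP->; rewrite mulr1.
Qed.

Lemma sub_eval x a : (val x : fock) a = '[x, proj_sub (orth M) (e a)].
Proof.
change ((val x : fock) a = '[val x, P (e a)]).
by rewrite hdot_orth_projr ?hdot_unit_vec //; exact: sub_hilbertP.
Qed.

Lemma vacuum_dot : '[vacuum, vacuum] = (mass empty)%:C.
Proof. by rewrite /mass sqnormE. Qed.

Lemma defect_vacuum : defect T vacuum = (mass empty)%:C *: vacuum.
Proof. by rewrite defectE sub_eval vacuum_dot. Qed.

Lemma defect_finite_rank : finite_rank (defect T).
Proof.
have [m0|m0] := eqVneq (mass empty) 0.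
  have v0 : vacuum = 0 by apply/eqP; rewrite -hdot_eq0 vacuum_dot m0.
  exists 0%N, (fun=> 0); split=> [[]//|a _ []//|_ [x _ <-]].
  by rewrite defectE v0 scaler0; exact: lin_span0.
have mC0 : (mass empty)%:C != 0 by rewrite -(inj_eq (@complexI R)) in m0.
exists 1%N, (fun=> vacuum); split=> [_|a|_ [x _ <-]].
- exists ((mass empty)%:C^-1 *: vacuum) => //.
  by rewrite defectE sub_eval hdotZl vacuum_dot mulVf // scale1r.
- rewrite big_ord1 => a0 i; rewrite (ord1 i).
  move/(congr1 (fun v => '[v, vacuum])): a0; rewrite hdotZl hdot0l vacuum_dot.
  by move/eqP; rewrite mulf_eq0 (negPf mC0) orbF => /eqP.
- by rewrite defectE; apply/lin_spanZ/lin_span_sub; exists ord0.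
Qed.

End Compression.

(** * Gauge-invariant subspaces and degree projections *)

Section DegreeProjections.
Variables (R : realType) (k : nat) (n : 'I_k -> nat).
Variable M : closed_subspace (fock R n).
Hypothesis M_graded : graded M.
Local Notation C := R[i].
Local Notation words := (words n).
Local Notation fock := (fock R n).
Implicit Types (f g h : fock) (a b c : words) (i : 'I_k).

Lemma fock_affineE (z w : C) f g a : (z *: (w *: f + g)) a = z * (w * f a + g a).
Proof. by []. Qed.

Lemma subspace_approx f :
  (forall r : C, 0 < r -> exists2 g, subspace_set M g & `|f - g| < r) ->
  subspace_set M f.
Proof.
move=> fM; apply: (@subspace_closed _ _ M) => B /nbhs_ballP[r r0 rB].
have [g Mg fg] := fM r r0; exists g; split=> //.
by apply: rB; rewrite -ball_normE.
Qed.

Lemma l2_tail f (r : C) : 0 < r -> exists A0 : {fset words},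
  forall A : {fset words}, \sum_(a <- (A `\` A0)%fset) `|f a| ^+ 2 <= r.
Proof.
move=> r0; have := @l2_dot_cvg _ _ _ f f.
move/(@cvgrPdist_le _ C) => /(_ r r0)[A0 _ A0P]; exists A0 => A.
have tail : `|l2_dot f f - \sum_(a <- A0) `|f a| ^+ 2| <= r.
  have -> : \sum_(a <- A0) `|f a| ^+ 2 = \sum_(a <- A0) '[f a, f a].
    by apply: eq_bigr => a _; rewrite hdotxx.
  exact: (A0P A0 (fsubset_refl _)).
have -> : (A `\` A0 = (A0 `|` A) `\` A0)%fset.
  by rewrite fsetDUl fsetDv fset0U.
rewrite -(@partial_sum_diff R words (fun a => `|f a| ^+ 2)) ?fsubsetUl //.
have total := @l2_dotxx_ge _ _ _ f (A0 `|` A)%fset.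
have sum_real (B : {fset words}) : \sum_(a <- B) `|f a| ^+ 2 \is Num.real.
  by rewrite ger0_real // sumr_ge0 // => a _; rewrite exprn_ge0.
apply: le_trans (lerB total (lexx _)) (le_trans (real_ler_norm _) tail).
rewrite rpredB // ger0_real //; apply: le_trans total.
by rewrite sumr_ge0 // => a _; rewrite exprn_ge0.
Qed.

(** A [z] with [z ^ d = -1] separates the classes of degrees modulo
    [2 d] inside each class modulo [d]. *)
Lemma root_power_class (z : C) (d c m : nat) : (0 < d)%N -> z ^+ d = -1 ->
  (m %% d = c %% d)%N ->
  (z ^+ c)^-1 * z ^+ m = if (m == c %[mod d * 2])%N then 1 else -1.
Proof.
move=> d0 zd mc; have z0 : z != 0.
  by apply: contra_eq_neq zd => ->;
    rewrite expr0n (gtn_eqF d0) eq_sym oppr_eq0 oner_eq0.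
have zE l : z ^+ l = (-1) ^+ odd (l %/ d) * z ^+ (l %% d).
  by rewrite {1}(divn_eq l d) exprD mulnC exprM zd signr_odd.
have classE l : (l %% (d * 2) = odd (l %/ d) * d + l %% d)%N.
  rewrite {1}(divn_eq (l %% (d * 2)) d) modn_dvdm ?dvdn_mulr //.
  by rewrite [(d * 2)%N]mulnC -modn_divl modn2.
rewrite (classE m) (classE c) (zE c) (zE m) mc eqn_add2r eqn_pmul2r
  // invfM mulrACA mulVf ?mulr1 ?expf_neq0 //.
by case: (odd _) (odd _) => -[];
  rewrite ?expr1 ?expr0 ?invr1 ?invrN1 ?mulr1 ?mul1r ?mulrNN ?mulr1.
Qed.

(** Halving a residue class only takes the average of the identity and a single
    gauge unitary, for a [2^r]-th root of -1. *)
Lemma residue_proj_in i (r c : nat) f : subspace_set M f ->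
  subspace_set M (coord_proj (fun a : words => size (a i) == c %[mod 2 ^ r])%N f).
Proof.
move=> Mf; elim: r => [|r IHr].
  rewrite (_ : coord_proj _ _ = f) //; apply: fock_ext => a.
  by rewrite coord_projE !modn1 eqxx.
have [h hE Mh] : exists2 h : fock, (forall a, h a =
    if (size (a i) == c %[mod 2 ^ r])%N then f a else 0) & subspace_set M h.
  by exists (coord_proj (fun a : words => size (a i) == c %[mod 2 ^ r])%N f) =>
    // a; exact: coord_projE.
pose z : C := (2 ^ r).-root (-1).
have d0 : (0 < 2 ^ r)%N by rewrite expn_gt0.
have zd : z ^+ (2 ^ r) = -1 by exact: rootCK.
have z1 : `|z| = 1.
  by apply/eqP; rewrite -(@pexpr_eq1 _ _ (2 ^ r)) // -normrX zd normrN1.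
pose u s : C := if s == i then z else 1.
have u1 s : `|u s| = 1 by rewrite /u; case: eqP; rewrite ?normr1.
have Mg : subspace_set M (2^-1 *: ((z ^+ c)^-1 *: gauge u h + h)).
  by apply: subspaceZ; exact: (subspaceP _ (M_graded u1 Mh) Mh).
suff -> : coord_proj (fun a : words => size (a i) == c %[mod 2 ^ r.+1])%N f =
  2^-1 *: ((z ^+ c)^-1 *: gauge u h + h) :> fock by exact: Mg.
apply: fock_ext => a.
apply: etrans _ (esym (fock_affineE _ _ _ _ a)).
rewrite (gaugeE h a u1).
have -> : \prod_(s < k) u s ^+ size (a s) = z ^+ size (a i).
  rewrite (bigD1 i) // big1 => [|s /negPf si]; last by rewrite /u si expr1n.
  by rewrite /u eqxx [LHS]mulr1.
rewrite hE coord_projE mulrA; move: (f a) => w.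
have [mc|mc] := eqVneq (size (a i) %% 2 ^ r)%N (c %% 2 ^ r)%N; last first.
  rewrite !mulr0 addr0 mulr0; case: ifP => // /eqP mc'.
  case/eqP: mc; rewrite -(@modn_dvdm (2 ^ r.+1) _ (2 ^ r)) ?dvdn_exp2l //.
  by rewrite mc' modn_dvdm // dvdn_exp2l.
rewrite (root_power_class d0 zd mc) -expnSr.
by case: ifP => _; [rewrite mul1r; field|rewrite mulN1r addNr mulr0].
Qed.

(** Apart from [c] itself, the degrees congruent to [c] modulo a large power of 2
    are large, so they only see the tail of [f]. *)
Lemma degree_proj_in i (c : nat) f : subspace_set M f ->
  subspace_set M (coord_proj (fun a : words => size (a i) == c) f).
Proof.
move=> Mf; apply: subspace_approx => r r0.
have r2 : 0 < (r / 2) ^+ 2 by rewrite exprn_gt0 // divr_gt0.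
have [A0 tail] := l2_tail f r2.
pose m := maxn c (\max_(a <- A0) size (a i)).
have m_lt : (m < 2 ^ m)%N by exact: ltn_expl.
exists (coord_proj (fun a : words => size (a i) == c %[mod 2 ^ m])%N f).
  exact: residue_proj_in.
apply: (@le_lt_trans _ _ (r / 2)); last by rewrite ltr_pdivrMr // ltr_pMr // ltr1n.
apply: l2_norm_le => [|A]; first by rewrite divr_ge0 // ltW.
set d := (_ - _).
have dE a : `|d a| ^+ 2 <= `|f a| ^+ 2.
  rewrite fock_subE !coord_projE.
  have [->|_] := eqVneq (size (a i)) c;
    first by rewrite eqxx subrr normr0 expr0n exprn_ge0.
  by case: ifP => _; rewrite ?subrr ?sub0r ?normrN ?normr0 ?expr0n ?exprn_ge0.
have d0 a : a \in A0 -> d a = 0.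
  move=> aA0; rewrite fock_subE !coord_projE modn_small.
    by rewrite modn_small ?subrr // (leq_ltn_trans _ m_lt) // leq_maxl.
  apply: leq_ltn_trans m_lt; rewrite leq_max; apply/orP; right.
  by rewrite (big_fsetD1 a aA0) leq_maxl.
clearbody d; rewrite (big_fsetID _ (mem A0)) /= [X in X + _]big_seq [X in X +
  _]big1 ?add0r.
  have -> : [fset a in A | a \notin A0]%fset = (A `\` A0)%fset.
    by apply/fsetP => a; rewrite !inE andbC.
  by apply: le_trans (ler_sum _ (fun a _ => dE a)) _; exact: tail.
by move=> a; rewrite !inE => /andP[_ /d0 ->]; rewrite normr0 expr0n.
Qed.

Lemma degree_upto_proj_in i (c : nat) f : subspace_set M f ->
  subspace_set M (coord_proj (fun a : words => size (a i) <= c)%N f).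
Proof.
move=> Mf; elim: c => [|c IHc].
  rewrite (_ : (fun a => _) = (fun a : words => size (a i) == 0%N)).
    exact: degree_proj_in.
  by apply/funext => a; rewrite leqn0.
rewrite (_ : coord_proj _ _ = coord_proj (fun a : words => size (a i) <= c)%N f +
  coord_proj (fun a : words => size (a i) == c.+1) f :> fock).
  by apply: subspaceD => //; exact: degree_proj_in.
apply: fock_ext => a; rewrite fock_addE !coord_projE leq_eqVlt ltnS.
have [->|_] := eqVneq (size (a i)) c.+1; first by rewrite ltnn add0r.
by rewrite addr0.
Qed.

Lemma proj_upto_in q f : subspace_set M f -> subspace_set M (proj_upto q f).
Proof.
move=> Mf.
suff H s :
  subspace_set M (coord_proj (fun a : words => all (fun i => size (a i) <= q i)%N s) f).
  have := H (enum 'I_k); congr (subspace_set M (coord_proj _ f)).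
  apply/funext => a; apply/allP/forallP => h i; last by move=> _; exact: h.
  by apply: h; rewrite mem_enum.
elim: s => [|i s IHs].
  rewrite (_ : coord_proj _ _ = f) //.
  by apply: fock_ext => a; rewrite coord_projE.
rewrite (_ : coord_proj _ _ = coord_proj (fun a : words => size (a i) <= q i)%N
  (coord_proj (fun a : words => all (fun i => size (a i) <= q i)%N s) f)).
  exact: degree_upto_proj_in.
apply: fock_ext => a; rewrite !coord_projE /=.
by case: (size (a i) <= q i)%N.
Qed.

Lemma proj_upto_orth_proj q f :
  orth_proj (orth M) (proj_upto q f) = proj_upto q (orth_proj (orth M) f).
Proof.
apply: orth_proj_unique => [m Mm|g Ng].
  by rewrite coord_proj_sa (orth_proj_in (orth M)) //; exact: proj_upto_in.
have -> : proj_upto q f - proj_upto q (orth_proj (orth M) f) =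
    proj_upto q (orth_proj M f).
  rewrite orth_proj_orth; apply: fock_ext => a.
  rewrite fock_subE !coord_projE fock_subE; case: ifP => _; last exact: subrr.
  by rewrite opprB addrC subrK.
rewrite hdotC Ng ?rmorph0 //; apply: proj_upto_in.
exact: (orth_proj_in M).
Qed.

End DegreeProjections.

(** * The compression defined by a graded invariant subspace *)

Section GradedCompression.
Variables (R : realType) (k : nat) (n : 'I_k -> nat).
Variable M : closed_subspace (fock R n).
Hypothesis M_invariant : creation_invariant M.
Hypothesis M_graded : graded M.
Local Notation C := R[i].
Local Notation words := (words n).
Local Notation fock := (fock R n).
Local Notation e := (@unit_vec R k n).
Local Notation P := (orth_proj (orth M)).
Local Notation T := (compression M).
Local Notation S := (@creation R k n).
Local Notation empty := (empty_words n).
Local Notation vacuum := (vacuum M).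
Local Notation mass := (mass M).
Implicit Types (f g : fock) (a b c : words) (i : 'I_k) (x y : sub_hilbert (orth M)).

Lemma coord_proj_level q f :
  coord_proj (level q) f = \sum_(a <- level_seq n q) f a *: e a :> fock.
Proof.
apply: coord_proj_finite; first exact: level_seq_uniq.
by move=> a; rewrite mem_level_seq.
Qed.

Lemma proj_uptoE q f : proj_upto q f = \sum_(a <- upto_seq n q) f a *: e a.
Proof.
apply: coord_proj_finite; first exact: upto_seq_uniq.
by move=> a; rewrite mem_upto_seq.
Qed.

Lemma fock_axpyE (z : C) f g a : (z *: f + g) a = z * f a + g a.
Proof. by []. Qed.

Lemma val_subZ (z : C) x : val (z *: x) = z *: val x.
Proof. by []. Qed.

Lemma proj_upto_linear q : linear (@proj_upto R k n q).
Proof.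
move=> z f g; apply: fock_ext => a.
have DE (h : fock) :
  proj_upto q h a = if upto q a then h a else 0 by exact: coord_projE.
apply: etrans (DE _) _; apply: etrans _ (esym (fock_axpyE z _ _ a)).
rewrite !DE (fock_axpyE z f g a).
by case: (upto q a); rewrite ?mulr0 ?addr0.
Qed.

Definition compressed_vec a : sub_hilbert (orth M) := proj_sub (orth M) (e a).

Lemma compressed_vec_dot a : '[compressed_vec a, compressed_vec a] = (mass a)%:C.
Proof. exact/esym/sqnormE. Qed.

Lemma word_op_S_proj i (w : seq 'I_(n i)) f :
  P (word_op S w (P f)) = P (word_op S w f).
Proof.
elim: w => [|j w IHw]; first by apply: orth_proj_id; exact: orth_proj_in.
apply: etrans (esym (orth_proj_creation M_invariant j (word_op S w (P f)))) _.
apply: etrans _ (orth_proj_creation M_invariant j (word_op S w f)).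
exact: (congr1 (fun g => P (creation j g)) IHw).
Qed.

Lemma val_word_op i (w : seq 'I_(n i)) x :
  val (word_op T w x) = P (word_op S w (val x)).
Proof.
elim: w => [|j w IHw]; first exact/esym/val_orth_proj.
apply: etrans _ (orth_proj_creation M_invariant j (word_op S w (val x))).
exact: (congr1 (fun g => P (creation j g)) IHw).
Qed.

Lemma val_words_op a x : val (words_op T a x) = P (words_op S a (val x)).
Proof.
rewrite /words_op; elim: (enum 'I_k) => [|i s IHs]; first exact/esym/val_orth_proj.
apply: etrans (val_word_op (a i) _) _; apply: etrans _ (word_op_S_proj (a i) _).
exact: (congr1 (fun g => P (word_op S (a i) g)) IHs).
Qed.

Lemma words_op_S_proj a f : P (words_op S a (P f)) = P (words_op S a f).
Proof.
rewrite /words_op; elim: (enum 'I_k) => [|i s IHs].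
  by apply: orth_proj_id; exact: orth_proj_in.
apply: etrans (esym (word_op_S_proj (a i) _)) _.
apply: etrans _ (word_op_S_proj (a i) _).
exact: (congr1 (fun g => P (word_op S (a i) g)) IHs).
Qed.

Lemma words_op_vacuum a (z : C) :
  words_op T a (z *: vacuum) = z *: compressed_vec a.
Proof.
apply: val_inj; rewrite val_words_op.
apply: etrans (congr1 (fun g => P (words_op S a g)) (esym (orth_projZ _ z (e
  empty)))) _.
apply: etrans (words_op_S_proj a (z *: e empty)) _.
apply: etrans (congr1 P (words_op_creation a z)) _.
exact: orth_projZ.
Qed.

(** [P] commutes with the projection onto the line of the empty multiword. *)
Lemma orth_proj_empty : P (e empty) = (mass empty)%:C *: e empty.
Proof.
have finE f : proj_upto (fun=> 0%N) f = f empty *: e empty :> fock.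
  rewrite /proj_upto (@coord_proj_finite _ _ _ [:: empty]) ?big_seq1 // => a.
  by rewrite inE upto0.
have fix_empty : proj_upto (fun=> 0%N) (e empty) = e empty.
  by rewrite finE unit_vecE eqxx scale1r.
rewrite -{1}fix_empty (proj_upto_orth_proj M_graded) finE massE.
by rewrite hdot_unit_vec.
Qed.

Lemma mass_vacuum : (mass empty)%:C *: vacuum = vacuum.
Proof.
apply: val_inj; change ((mass empty)%:C *: P (e empty) = P (e empty)).
rewrite -orth_projZ -orth_proj_empty orth_proj_id //.
exact: orth_proj_in.
Qed.

(** The vacuum has mass 1, unless [N] is zero and all these vectors vanish; this
    identity treats both cases at once. *)
Lemma compressed_vec_mass a : (mass empty)%:C *: compressed_vec a =
  compressed_vec a.
Proof.
by rewrite -words_op_vacuum mass_vacuum -[vacuum]scale1r words_op_vacuum scale1r.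
Qed.

Lemma defect_dot x : defect T x = '[x, vacuum] *: vacuum.
Proof. by rewrite (defectE M_invariant) sub_eval. Qed.

Lemma defect_vacuum_id : defect T vacuum = vacuum.
Proof. by rewrite (defect_vacuum M_invariant) mass_vacuum. Qed.

Lemma defect_bounded : bounded_linear (defect T).
Proof.
apply: bounded_linear_norm_le => [z x y|x].
  by rewrite !defect_dot hdotDl hdotZl scalerDl scalerA.
have v1 : `|vacuum| <= 1.
  rewrite -(@ler_pXn2r _ 2) ?nnegrE // expr1n -hdotxx (vacuum_dot M).
  by rewrite lecR; case/andP: (mass_bounds M empty).
rewrite defect_dot normrZ; apply: le_trans (ler_wpM2r _ (hdot_norm_le _ _)) _ => //.
by rewrite -mulrA ler_piMr // mulr_ile1.
Qed.

(** The defect is the projection onto the (possibly zero) line of the vacuum,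
    so it is its own positive square root. *)
Lemma sqrt_defect : sqrt_op (defect T) = defect T.
Proof.
apply: sqrt_op_idempotent;
  [exact: defect_bounded|exact: (defect_of_positive M_invariant)|].
apply/funext => x; rewrite /comp (defect_dot (defect T x)) (defect_dot x).
by rewrite hdotZl (vacuum_dot M) -scalerA mass_vacuum.
Qed.

Lemma val_adjoint_word_op i (w : seq 'I_(n i)) y c :
  (val (adjoint (word_op T w) y) : fock) c = (val y : fock) (prefix_at w c).
Proof.
suff [B BA BE] : exists2 B : sub_hilbert (orth M) -> sub_hilbert (orth M),
    (forall x y, '[word_op T w x, y] = '[x, B y]) &
    forall y c, (val (B y) : fock) c = (val y : fock) (prefix_at w c).
  by rewrite (adjoint_eq BA) BE.
elim: w => [|j w [B BA BE]].
  by exists id => // z d; rewrite prefix_at_nil.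
exists (fun y => B (compression_adj j y)) => [x z|z d].
  change ('[T i j (word_op T w x), z] = '[x, B (compression_adj j z)]).
  apply: (@etrans _ _ '[word_op T w x, compression_adj j z]); last exact: BA.
  exact: (compression_dot M_invariant j (word_op T w x) z).
by rewrite BE (val_compression_adj M_invariant) annihilationE prefix_at_cons.
Qed.

Lemma words_adj_empty a x : (val (words_adj T a x) : fock) empty = (val x : fock) a.
Proof.
suff H s : uniq s -> forall c,
    (val (foldr (fun i => adjoint (word_op T (a i))) x s) : fock) c =
    (val x : fock) (prefix_on s a c).
  by rewrite /words_adj H ?enum_uniq // prefix_on_all.
elim: s => [_ c|i s IHs /andP[is_ s_uniq] c]; first by rewrite prefix_on_nil.
apply: etrans (val_adjoint_word_op (a i) _ c) _.
by rewrite IHs // prefix_on_consr.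
Qed.

Lemma vacuum_defect_space : subspace_set (defect_space T) vacuum.
Proof.
apply: subset_closure; apply: lin_span_sub.
by exists vacuum => //; exact: defect_vacuum_id.
Qed.

Definition defect_unit : sub_hilbert (defect_space T) :=
  SubHilbert (asboolT vacuum_defect_space).

Lemma defect_unit_dot : '[defect_unit, defect_unit] = (mass empty)%:C.
Proof. exact: (vacuum_dot M). Qed.

Lemma sqsummable_scale (W : hilbertType R) (w : W) f :
  sqsummable (fun a : words => f a *: w).
Proof.
have [K fK] := l2P f; exists (K * `|w| ^+ 2) => A.
under eq_bigr do rewrite normrZ exprMn.
by rewrite -mulr_suml ler_wpM2r ?exprn_ge0.
Qed.

(** The Berezin kernel is the inclusion of [N] in the Fock space, tensored with
    the vacuum. *)
Lemma berezinE x b : berezin T x b = (val x : fock) b *: defect_unit.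
Proof.
rewrite /berezin sqrt_defect (_ : (fun b => _) =
  fun b => (val x : fock) b *: defect_unit).
  by rewrite to_l2E //; exact: sqsummable_scale.
apply/funext => c; rewrite (defectE M_invariant) words_adj_empty.
apply: val_inj; rewrite insubdK //.
apply/asboolP; apply: (@subspaceZ _ _ (defect_space T)).
exact: vacuum_defect_space.
Qed.

Local Notation defect_fock := (l2 words (sub_hilbert (defect_space T))).

Lemma sqsummable_coeff (g : defect_fock) :
  sqsummable (fun b : words => '[g b, defect_unit] : C).
Proof.
have [K gK] := l2P g; exists (K * `|defect_unit| ^+ 2) => A.
apply: le_trans (_ : \sum_(b <- A) `|g b| ^+ 2 * `|defect_unit| ^+ 2 <= _).
  apply: ler_sum => b _; rewrite -exprMn ler_pXn2r ?nnegrE ?mulr_ge0 //.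
  exact: hdot_norm_le.
by rewrite -mulr_suml ler_wpM2r ?exprn_ge0.
Qed.

Definition berezin_adj (g : defect_fock) : sub_hilbert (orth M) :=
  proj_sub (orth M) (to_l2 (fun b : words => '[g b, defect_unit] : C)).

Lemma adjoint_berezin : adjoint (berezin T) = berezin_adj.
Proof.
apply: adjoint_eq => x g.
change ('[berezin T x, g] =
  '[val x, P (to_l2 (fun b : words => '[g b, defect_unit] : C))]).
rewrite (hdot_orth_projr _ (sub_hilbertP x)).
apply: l2_dot_ext => b; rewrite berezinE to_l2E; last exact: sqsummable_coeff.
by rewrite hdotZl (hdotC defect_unit).
Qed.

Lemma berezin_level q x :
  adjoint (berezin T) (coord_proj (level q) (berezin T x)) =
  \sum_(a <- level_seq n q) '[x, compressed_vec a] *: compressed_vec a.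
Proof.
rewrite adjoint_berezin; apply: val_inj; rewrite val_sum.
pose h : fock := (mass empty)%:C *: val x.
have hE b : h b = (mass empty)%:C * (val x : fock) b by exact: fock_scaleE.
have -> : val (berezin_adj (coord_proj (level q) (berezin T x))) =
    P (coord_proj (level q) h).
  apply: (congr1 P); apply: fock_ext => b.
  rewrite to_l2E; last exact: sqsummable_coeff.
  have -> : coord_proj (level q) (berezin T x) b =
      (if level q b then (val x : fock) b else 0) *: defect_unit.
    rewrite coord_projE berezinE; case: (level q b); first by [].
    by rewrite scale0r.
  apply: etrans _ (esym (coord_projE (level q) h b)).
  rewrite hdotZl defect_unit_dot hE; move: ((val x : fock) b) => w.
  by case: (level q b); rewrite ?mul0r // mulrC.
apply: etrans (congr1 P (coord_proj_level q h)) _.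
rewrite orth_proj_sum; apply: eq_bigr => a _.
have fixed : (mass empty)%:C *: P (e a) = P (e a).
  change ((mass empty)%:C *: val (compressed_vec a) = val (compressed_vec a)).
  by rewrite -val_subZ compressed_vec_mass.
rewrite orth_projZ hE mulrC -scalerA fixed.
exact: (congr1 (fun z => z *: P (e a)) (sub_eval x a)).
Qed.

Let sum_mass (s : seq words) :
  \sum_(a <- s) '[compressed_vec a, compressed_vec a] = (\sum_(a <- s) mass a)%:C.
Proof.
by rewrite rmorph_sum; apply: eq_bigr => a _; exact: compressed_vec_dot.
Qed.

Lemma trace_berezin_level q :
  op_trace (adjoint (berezin T) \o coord_proj (level q) \o berezin T) =
  (\sum_(a <- level_seq n q) mass a)%:C.
Proof.
apply: op_trace_eq; rewrite -sum_mass; apply: has_trace_finite_rank => x.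
exact: berezin_level.
Qed.

Let trace_coord (D : pred words) (s : seq words) : uniq s ->
  (forall a, D a = (a \in s)) ->
  op_trace (@coord_proj R words C D : fock -> fock) = (size s)%:R.
Proof.
move=> s_uniq Ds; apply: op_trace_eq.
have -> : (size s)%:R = \sum_(a <- s) '[e a, e a] :> C.
  rewrite -sum1_size natr_sum; apply: eq_bigr => a _.
  by rewrite unit_vec_dot eqxx.
apply: has_trace_finite_rank => f.
by rewrite (coord_proj_finite _ s_uniq Ds); apply: eq_bigr => a _;
  rewrite hdot_unit_vec.
Qed.

Lemma curv_termE q : curv_term T q = (level_average mass q)%:C.
Proof.
rewrite /curv_term trace_berezin_level /proj_level.
rewrite (@trace_coord _ (level_seq n q)) ?level_seq_uniq //; last first.
  by move=> a; rewrite mem_level_seq.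
by rewrite size_level_seq /level_average rmorphM fmorphV rmorph_nat.
Qed.

Lemma trace_proj_upto q : op_trace (@proj_upto R k n q) = (size (upto_seq n q))%:R.
Proof.
apply: trace_coord; first exact: upto_seq_uniq.
by move=> a; rewrite mem_upto_seq.
Qed.

Lemma rank_proj_upto q : op_rank (@proj_upto R k n q) = size (upto_seq n q).
Proof.
have es_inj : injective e.
  move=> a b /(congr1 (fun f : fock => f a)); rewrite !unit_vecE eqxx.
  by case: eqP => // _ /eqP; rewrite oner_eq0.
rewrite /op_rank -(size_map e); apply: dim_eq; apply: has_dim_orthonormal.
- split; first by rewrite map_inj_uniq ?upto_seq_uniq.
  by move=> _ _ /mapP[a _ ->] /mapP[b _ ->];
    rewrite unit_vec_dot (inj_eq es_inj) eq_sym.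
- move=> u /mapP[a aq ->]; exists (e a) => //; rewrite mem_upto_seq in aq.
  apply: fock_ext => b; rewrite coord_projE unit_vecE.
  by case: eqP => [->|_]; rewrite ?aq // if_same.
- move=> _ [f _ <-]; rewrite big_map.
  apply: etrans (proj_uptoE q f) _.
  rewrite [LHS]big_seq [RHS]big_seq; apply: eq_bigr => a;
    rewrite mem_upto_seq => aq.
  by rewrite hdot_unit_vec coord_projE aq.
Qed.

Lemma compressed_proj_uptoE q f : P (proj_upto q f) =
  \sum_(a <- upto_seq n q) '[f, e a] *: val (compressed_vec a).
Proof.
apply: etrans (congr1 P (proj_uptoE q f)) _; rewrite orth_proj_sum;
  apply: eq_bigr => a _.
by rewrite orth_projZ hdot_unit_vec.
Qed.

Lemma trace_compressed_proj_upto q :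
  has_trace (P \o proj_upto q) ((\sum_(a <- upto_seq n q) mass a)%:C).
Proof.
rewrite rmorph_sum (eq_bigr (fun a => '[val (compressed_vec a), e a])); last first.
  by move=> a _; exact: massE.
by apply: has_trace_finite_rank => f; exact: compressed_proj_uptoE.
Qed.

Lemma euler_spaceE q :
  euler_space T q = lin_span [set` [seq compressed_vec a | a <- upto_seq n q]].
Proof.
have span_closed (A : set (sub_hilbert (orth M))) z u v :
  lin_span A u -> lin_span A v -> lin_span A (z *: u + v) by exact: lin_spanP.
apply/seteqP; split; apply: lin_span_ind; try exact: lin_span0;
  try exact: span_closed.
- move=> _ [a [_ [aq [x _ <-] ->]]].
  rewrite (defectE M_invariant) words_op_vacuum; apply/lin_spanZ/lin_span_sub.
  by apply/mapP; exists a; rewrite ?mem_upto_seq.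
- move=> _ /mapP[a aq ->]; apply: lin_span_sub; exists a, vacuum; split.
  + by rewrite -mem_upto_seq.
  + by exists vacuum => //; exact: defect_vacuum_id.
  + by rewrite -[in RHS](scale1r vacuum) words_op_vacuum scale1r.
Qed.

(** Because [M] is graded, [P] commutes with the projection onto the words of
    length at most [q], so their product is an orthogonal projection, whose rank
    is its trace; and its range is the space counted by the Euler
    characteristic. *)
Lemma dim_mass q :
  exists d, [/\ op_rank (P \o proj_upto q) = d, Defs.dim (euler_space T q) = d &
    d%:R = \sum_(a <- upto_seq n q) mass a :> R].
Proof.
have [|f g|f|a|d [rankA dimA traceA]] := @projection_rank_trace R fock (orth M)
    (P \o proj_upto q) words (upto_seq n q) e compressed_vec.
- move=> z f g.
  change (P (proj_upto q (z *: f + g)) = z *: P (proj_upto q f) + P (proj_upto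
    q g)).
  by rewrite (proj_upto_linear q z f g) orth_projD orth_projZ.
- apply: etrans (orth_proj_sa _ _ _) _; apply: etrans (coord_proj_sa _ _ _) _.
  exact: (congr1 (fun h => '[f, h]) (esym (proj_upto_orth_proj M_graded q g))).
- exact: compressed_proj_uptoE.
- rewrite mem_upto_seq => aq; change (P (proj_upto q (P (e a))) = P (e a)).
  apply: etrans (congr1 P (esym (proj_upto_orth_proj M_graded q (e a)))) _.
  apply: etrans (orth_proj_id (orth_proj_in _ _)) _.
  apply: (congr1 P); apply: fock_ext => b.
  apply: etrans (coord_projE (upto q) (e a) b) _; rewrite unit_vecE.
  by case: eqP => [->|_]; rewrite ?aq // if_same.
exists d; split=> //; first by rewrite euler_spaceE.
apply: complexI; rewrite -(op_trace_eq (@trace_compressed_proj_upto q)).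
by rewrite (op_trace_eq traceA) rmorph_nat.
Qed.

End GradedCompression.

(** * Identification of the limits *)

Section Averages.
Variables (R : realType) (k : nat) (n : 'I_k -> nat).
Variable M : closed_subspace (fock R n).
Hypothesis M_invariant : creation_invariant M.
Hypothesis M_graded : graded M.
Hypothesis n_gt0 : forall i, (0 < n i)%N.
Local Notation C := R[i].
Local Notation P := (orth_proj (orth M)).

Lemma rank_ratio q :
  (op_rank (P \o proj_upto q))%:R / (op_rank (@proj_upto R k n q))%:R =
  (upto_average (mass M) q)%:C :> C.
Proof.
have [d [-> _ dE]] := dim_mass M_invariant M_graded q.
rewrite rank_proj_upto (size_upto_seq R n_gt0) /upto_average -dE.
by rewrite rmorphM fmorphV !rmorph_nat.
Qed.

Lemma euler_ratio q :
  (Defs.dim (euler_space (compression M) q))%:R /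
    (\prod_(i < k) \sum_(j < (q i).+1) n i ^ j)%N%:R =
  (upto_average (mass M) q)%:C :> C.
Proof.
have [d [_ -> dE]] := dim_mass M_invariant M_graded q.
by rewrite /upto_average -dE rmorphM fmorphV !rmorph_nat.
Qed.

Lemma trace_ratio q :
  op_trace (P \o proj_upto q) / op_trace (@proj_upto R k n q) =
  (upto_average (mass M) q)%:C.
Proof.
rewrite trace_proj_upto (op_trace_eq (@trace_compressed_proj_upto _ _ _ M q)).
by rewrite (size_upto_seq R n_gt0) /upto_average rmorphM fmorphV rmorph_nat.
Qed.

End Averages.

Theorem theorem3p4 (R : realType) (k : nat) (n : 'I_k -> nat)
  (M : closed_subspace (fock R n))
  (k_gt0 : (0 < k)%N) (n_ge2 : forall i, (2 <= n i)%N)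
  (M_invariant : creation_invariant M) (M_graded : graded M) :
  [/\ in_polyball (compression M),
      finite_rank (defect (compression M)) &
      exists rank_lim trace_lim : R[i],
        [/\ iter_lim (fun q : 'I_k -> nat =>
              (op_rank (orth_proj (orth M) \o proj_upto q))%:R /
              (op_rank (@proj_upto R k n q))%:R) rank_lim,
            iter_lim (fun q : 'I_k -> nat =>
              op_trace (orth_proj (orth M) \o proj_upto q) /
              op_trace (@proj_upto R k n q)) trace_lim,
            rank_lim = trace_lim,
            is_euler_char (compression M) rank_lim &
            is_curvature (compression M) trace_lim]].
Proof.
have n_gt0 i : (0 < n i)%N by apply: ltnW.
have mass_le i (j : 'I_(n i)) a : mass M (prepend j a) <= mass M a.
  exact: mass_prepend.
have avg_bounds := level_average_bounds n_gt0 (mass_bounds M).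
have [l l_glb _] := @glb_exists R k (level_average (mass M)) 0
  (fun q => proj1 (andP (avg_bounds q))).
have upto_glb := upto_average_glb n_gt0 mass_le l_glb.
have upto_anti := upto_average_antitone n_gt0 mass_le.
split; first exact: compression_in_polyball.
  exact: defect_finite_rank.
exists l%:C, l%:C; split => //.
- rewrite (_ : (fun q => _) = fun q => (upto_average (mass M) q)%:C); last first.
    by apply/funext => q; exact: rank_ratio.
  exact: antitone_iter_lim.
- rewrite (_ : (fun q => _) = fun q => (upto_average (mass M) q)%:C); last first.
    by apply/funext => q; exact: trace_ratio.
  exact: antitone_iter_lim.
- move=> q q_incr q_cof.
  rewrite (_ : (fun m => _) = fun m => (upto_average (mass M) (q m))%:C);
    last first.
    by apply/funext => m; exact: euler_ratio.
  exact: antitone_cofinal_cvg.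
- rewrite /is_curvature (_ : (fun m => _) = fun m => (('C(m + k, k)%:R)^-1 *
     \sum_(q : {ffun 'I_k -> 'I_m.+1} | (\sum_(i < k) q i <= m)%N)
        level_average (mass M) (fun i => q i))%:C); last first.
    apply/funext => m; rewrite rmorphM fmorphV rmorph_nat rmorph_sum.
    by congr (_ * _); apply: eq_bigr => q _; exact: curv_termE.
  apply: simplex_average_cvg => //.
  exact: level_average_antitone.
Qed.
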